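(* On $\mathbf{C}^2$ with coordinates $(z_1,z_2)$, $z_j=x_j+iy_j$, identified with $\mathbf{R}^4$ with coordinates $(x_1,y_1,x_2,y_2)$, let $J$ be the almost complex structure given at the point $(x_1,y_1,x_2,y_2)$ by the matrix $$J=\begin{pmatrix}0&-1&0&0\\ 1&0&0&0\\ -2y_2&-2x_2&0&-1\\ -2x_2&2y_2&1&0\end{pmatrix}.$$ Equivalently, a map $\zeta\mapsto u(\zeta)=(u_1(\zeta),u_2(\zeta))$ is $J$-holomorphic if and only if $u_1$ is holomorphic and $\frac{\partial \overline{u_2}}{\partial\zeta}=u_2\,\frac{\partial u_1}{\partial\zeta}$. Then there is no $J$-plurisubharmonic function $\lambda$, defined on a neighborhood of $0$ in $\mathbf{C}^2$ and not identically $-\infty$ near $0$, such that $\lambda(z_1,z_2)\leq \log|z_2|$.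
   Context: An almost complex structure $J$ assigns to each point an $\mathbf{R}$-linear endomorphism of the tangent space with $J^2=-\mathbf{1}$. A map $u$ from an open subset of $\mathbf{C}$ (coordinate $\zeta=x+iy$) is $J$-holomorphic if $\frac{\partial u}{\partial y}=J(u)\frac{\partial u}{\partial x}$. Definition of $J$-plurisubharmonicity: an upper semi-continuous (hence continuous) function $\lambda$ with values in $[-\infty,+\infty)$ is $J$-plurisubharmonic if $\lambda$ is of class $\mathcal{C}^2$ off its $-\infty$ set $\{\lambda=-\infty\}$ and if its restriction to any $J$-holomorphic curve is subharmonic (i.e. $\lambda\circ u$ is subharmonic, the function identically $-\infty$ being allowed, for every $J$-holomorphic map $u$ from a disc in $\mathbf{C}$ into the domain of $\lambda$). *)

(* Defs.v *)
From HB Require Import structures.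
From mathcomp Require Import all_boot all_order all_algebra.
From mathcomp Require Import all_classical all_reals all_analysis.
From mathcomp Require Import complex.

Set Implicit Arguments.
Unset Strict Implicit.
Unset Printing Implicit Defensive.

Import Order.TTheory GRing.Theory Num.Theory.
Import numFieldNormedType.Exports Normc.

Local Open Scope classical_set_scope.
Local Open Scope ring_scope.
Local Open Scope complex_scope.

(* [R[i]^o] is the complex plane with the topology of its modulus; [derivable]
   over the field [R[i]] is complex differentiability. *)
Definition holomorphic_on (R : realType) (D : set R[i]^o)
    (f : R[i]^o -> R[i]^o) : Prop :=
  forall zeta, D zeta -> derivable f zeta 1.

(* The real directions 1 and i at [zeta]; for a map [u] defined on the complex
   plane, the partial derivatives in x and y are the derivatives at 0 of the
   restrictions of [u] to these two lines. *)
Definition xline (R : realType) (zeta : R[i]^o) (t : R) : R[i]^o :=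
  (zeta : R[i]) + t%:C.
Definition yline (R : realType) (zeta : R[i]^o) (t : R) : R[i]^o :=
  (zeta : R[i]) + t *i.

Definition dx (R : realType) (V : normedModType R) (u : R[i]^o -> V)
    (zeta : R[i]^o) : V := 'D_1 (u \o xline zeta) (0 : R).
Definition dy (R : realType) (V : normedModType R) (u : R[i]^o -> V)
    (zeta : R[i]^o) : V := 'D_1 (u \o yline zeta) (0 : R).

Definition C1_on (R : realType) (V : normedModType R) (D : set R[i]^o)
    (u : R[i]^o -> V) : Prop :=
  forall zeta, D zeta ->
    [/\ derivable (u \o xline zeta) (0 : R) 1,
        derivable (u \o yline zeta) (0 : R) 1,
        {for zeta, continuous (dx u)} & {for zeta, continuous (dy u)}].

(* The Wirtinger derivative (d/dx - i d/dy) / 2 of a complex-valued map. *)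
Definition dzeta (R : realType) (f : R[i]^o -> R[i]) (zeta : R[i]^o) : R[i] :=
  let fx := dx (fun w => complex.Re (f w)) zeta +i* dx (fun w => complex.Im (f w)) zeta in
  let fy := dy (fun w => complex.Re (f w)) zeta +i* dy (fun w => complex.Im (f w)) zeta in
  (fx - 'i * fy) / 2%:R.

Fixpoint Ck_on (R : realType) (V : normedModType R) (k : nat) (U : set V)
    (f : V -> R) : Prop :=
  if k is k'.+1 then
    (forall p, U p -> differentiable f p) /\ (forall v, Ck_on k' U ('D_v f))
  else forall p, U p -> {for p, continuous f}.

Definition upper_semicontinuous_on (R : realType) (T : topologicalType)
    (U : set T) (f : T -> \bar R) : Prop :=
  forall p, U p -> forall a : R, (f p < a%:E)%E ->
    \forall q \near p, (f q < a%:E)%E.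

Definition disc (R : realType) (c : R[i]^o) (r : R) : set R[i]^o :=
  [set zeta | normc ((zeta : R[i]) - c) < r].

Definition closed_disc (R : realType) (c : R[i]^o) (r : R) : set R[i]^o :=
  [set zeta | normc ((zeta : R[i]) - c) <= r].

Definition circle_mean (R : realType) (v : R[i]^o -> \bar R) (c : R[i]^o)
    (r : R) : \bar R :=
  (((2 * pi)^-1)%:E * \int[lebesgue_measure]_(theta in `[0%R, (2 * pi)%R])
     v ((c : R[i]) + r%:C * (cos theta +i* sin theta))%R)%E.

Definition subharmonic_on (R : realType) (D : set R[i]^o)
    (v : R[i]^o -> \bar R) : Prop :=
  [/\ forall zeta, D zeta -> (v zeta < +oo)%E,
      upper_semicontinuous_on D v &
      forall (c : R[i]^o) (r : R), 0 < r -> closed_disc c r `<=` D ->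
        (v c <= circle_mean v c r)%E].

Definition almost_complex_structure (R : realType) (n : nat)
    (J : 'cV[R]_n -> 'M[R]_n) : Prop :=
  forall p, J p *m J p = - 1%:M.

Definition J_holomorphic_on (R : realType) (n : nat)
    (J : 'cV[R]_n -> 'M[R]_n) (D : set R[i]^o) (u : R[i]^o -> 'cV[R]_n) :
    Prop :=
  C1_on D u /\
  forall zeta, D zeta -> dy u zeta = J (u zeta) *m dx u zeta.

(* Being of class C^2 off {lambda = -oo} presupposes that this set is
   relatively closed, which is the second condition. *)
Definition J_plurisubharmonic_on (R : realType) (n : nat)
    (J : 'cV[R]_n -> 'M[R]_n) (Omega : set 'cV[R]_n)
    (lambda : 'cV[R]_n -> \bar R) : Prop :=
  let finite_set := Omega `&` [set p | lambda p != -oo%E] in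
  [/\ (forall p, Omega p -> (lambda p < +oo)%E) /\
        upper_semicontinuous_on Omega lambda,
      open finite_set,
      Ck_on 2 finite_set (fine \o lambda) &
      forall (c : R[i]^o) (r : R) (u : R[i]^o -> 'cV[R]_n),
        0 < r -> J_holomorphic_on J (disc c r) u ->
        (forall zeta, disc c r zeta -> Omega (u zeta)) ->
        subharmonic_on (disc c r) (lambda \o u)].

(* Points of C^2 are columns (x_1, y_1, x_2, y_2) of R^4. *)
Definition z1 (R : realType) (p : 'cV[R]_4) : R[i] := p 0 0 +i* p 1 0.
Definition z2 (R : realType) (p : 'cV[R]_4) : R[i] := p 2 0 +i* p 3 0.

Definition Jmx (R : realType) (p : 'cV[R]_4) : 'M[R]_4 :=
  let x2 := p 2 0 in
  let y2 := p 3 0 in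
  \matrix_(i < 4, j < 4) nth 0 (nth [::]
    [:: [:: 0;          -1;         0; 0];
        [:: 1;          0;          0; 0];
        [:: - (2 * y2); - (2 * x2); 0; -1];
        [:: - (2 * x2); 2 * y2;     1; 0]] i) j.

(* Main.v *)
(* Let lambda be J-plurisubharmonic with lambda <= log |z2|, and rescale to
   |z1|^2 <= E0, |z2| <= rho with rho <= 1, so that lambda <= -t where
   t = log (rho / |z2|). The curves u1 = z1 + zeta, with u2 a solution of
   d u2 / d conj zeta = conj u2, bend log |u2| downwards at a rate proportional
   to |d u2 / d zeta| / |z2|, a quantity that can be chosen freely.
   For this reason -(E - |z1|^2) f(t), with f linear or slightly concave, fails
   to be subharmonic along some such curve through almost every point. A
   correction of lower order (see [barrier]) takes care of the arguments of z2
   for which the mixed term of the Levi form vanishes, and the maximum principle on {|z1|^2 <= E, 0 <= t <= L}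
   shows that lambda <= -k (E - |z1|^2) for t >= L implies
   lambda <= -k (1/2 + s/4) (E' - |z1|^2) for t >= L/2, where s > 0 is fixed and
   E - E' = O(L^-2). Starting from lambda <= -2^N for t >= 2^N and halving N
   times gives lambda <= -(1 + s/2)^N (E0/2 - |z1|^2) for t >= 1, for every N,
   so lambda = -oo near 0. Only the sub-mean value property and the upper
   semicontinuity of lambda are used. *)
Require Import Defs.
From HB Require Import structures.
From mathcomp Require Import all_boot all_order all_algebra.
From mathcomp Require Import all_classical all_reals all_analysis.
From mathcomp Require Import complex.
From mathcomp Require Import ring lra.
Import Order.TTheory GRing.Theory Num.Theory.
Import numFieldNormedType.Exports Normc.
Local Open Scope classical_set_scope.
Local Open Scope ring_scope.
Local Open Scope complex_scope.

Set Implicit Arguments.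
Unset Strict Implicit.
Unset Printing Implicit Defensive.

(** * Second-order expansions with uniform remainder *)

(** Two reductions make the computation finite. The equation dV / d conj zeta = conj V is solved by
    real combinations of exp(2x), i exp(-2x), (1 + i) exp(-2y) and (1 - i) exp(2y), just enough to
    prescribe V(0) and b = dV / d zeta (0). A rotation removes the argument of z2, so that the
    barrier along such a disc depends only on t and Z = z1 z2 / conj z2. The Laplacian of log |V| at
    0 is 4 - 4 Re b, with no term in |b|^2; the Levi form of the barrier is therefore - c (Re Z +
    g/2) |b|^2, with g = E - |z1|^2, plus a mixed term linear in b and a bounded term. Where Re Z +
    g/2 >= 0 the mixed coefficient has size at least about E / L, and with c = s / L^2 its square
    divided by c is of order E^2 / s whatever L is. Hence s need only be small against E^2 and stays
    the same through all the halvings. Laplacians are read off from second-order expansions with a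
    uniform cubic remainder, whose circle means are explicit. *)

Section Jets.
Variables (R : realType) (T : Type) (P : T -> Prop).
Implicit Types (e : R -> T -> R).

(* Eventually as [r] tends to 0 from the right, uniformly in [t] with [P t]. *)
Definition near0 (Q : R -> T -> Prop) : Prop :=
  exists2 d : R, 0 < d & forall r t, 0 <= r <= d -> P t -> Q r t.

Lemma near0_and Q1 Q2 : near0 Q1 -> near0 Q2 -> near0 (fun r t => Q1 r t /\ Q2 r t).
Proof.
move=> [d1 d1p H1] [d2 d2p H2]; exists (Num.min d1 d2).
  by rewrite lt_min d1p d2p.
move=> r t /andP[r0]; rewrite le_min => /andP[rd1 rd2] Pt.
by split; [apply: H1|apply: H2]; rewrite // r0.
Qed.

Lemma near0_imp Q1 Q2 : (forall r t, 0 <= r -> P t -> Q1 r t -> Q2 r t) -> near0 Q1 -> near0 Q2.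
Proof.
move=> H [d dp Hd]; exists d => // r t rd Pt.
by apply: H => //; [case/andP: rd|apply: Hd].
Qed.

Lemma near0_true Q : (forall r t, 0 <= r -> P t -> Q r t) -> near0 Q.
Proof. by move=> H; exists 1 => // r t /andP[r0 _] Pt; apply: H. Qed.

Lemma near0_le (d : R) : 0 < d -> near0 (fun r _ => r <= d).
Proof. by move=> dp; exists d => // r t /andP[]. Qed.

Definition bounded0 e : Prop := exists C : R, near0 (fun r t => `|e r t| <= C).

Lemma bounded0_cst (a : R) : bounded0 (fun _ _ => a).
Proof. by exists `|a|; apply: near0_true. Qed.

Lemma bounded0_var : bounded0 (fun r _ => r).
Proof.
by exists 1; exists 1 => // r t /andP[r0 r1] _; rewrite ger0_norm.
Qed.

Lemma bounded0D e1 e2 : bounded0 e1 -> bounded0 e2 -> bounded0 (fun r t => e1 r t + e2 r t).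
Proof.
move=> [C1 H1] [C2 H2]; exists (C1 + C2).
apply: near0_imp (near0_and H1 H2) => r t _ _ [h1 h2].
by rewrite (le_trans (ler_normD _ _))// lerD.
Qed.

Lemma bounded0M e1 e2 : bounded0 e1 -> bounded0 e2 -> bounded0 (fun r t => e1 r t * e2 r t).
Proof.
move=> [C1 H1] [C2 H2]; exists (C1 * C2).
apply: near0_imp (near0_and H1 H2) => r t _ _ [h1 h2].
by rewrite normrM ler_pM.
Qed.

(** The remainder is an exact term r^3 e with e bounded, so that sums, products and compositions of
    expansions reduce to identities for [ring]. The constant [k0] does not depend on the direction
    t, all rays starting at the same point. *)
Definition jet (k : R -> T -> R) (k0 : R) (k1 k2 : T -> R) : Prop :=
  [/\ bounded0 (fun _ => k1), bounded0 (fun _ => k2) &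
   exists2 e, bounded0 e &
     near0 (fun r t => k r t = k0 + r * (k1 t + r * (k2 t + r * e r t)))].

Lemma jet_cst (a : R) : jet (fun _ _ => a) a (fun=> 0) (fun=> 0).
Proof.
split; try exact: bounded0_cst.
exists (fun _ _ => 0); first exact: bounded0_cst.
by apply: near0_true => r t _ _; ring.
Qed.

Lemma jet_lin (f : T -> R) : bounded0 (fun _ => f) ->
  jet (fun r t => r * f t) 0 f (fun=> 0).
Proof.
move=> bf; split=> //; try exact: bounded0_cst.
exists (fun _ _ => 0); first exact: bounded0_cst.
by apply: near0_true => r t _ _; ring.
Qed.

Lemma jet_ext k k' k0 k0' k1 k2 k1' k2' : jet k k0 k1 k2 ->
  (forall r t, k r t = k' r t) -> k0 = k0' ->
  (forall t, k1 t = k1' t) -> (forall t, k2 t = k2' t) ->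
  jet k' k0' k1' k2'.
Proof.
move=> + E <- /funext <- /funext <-.
by have -> // : k = k' by apply/funext => r; apply/funext => t.
Qed.

Lemma jetD k k0 k1 k2 l l0 l1 l2 : jet k k0 k1 k2 -> jet l l0 l1 l2 ->
  jet (fun r t => k r t + l r t) (k0 + l0) (fun t => k1 t + l1 t) (fun t => k2 t + l2 t).
Proof.
move=> [bk1 bk2 [e be He]] [bl1 bl2 [e' be' He']]; split; try exact: bounded0D.
exists (fun r t => e r t + e' r t); first exact: bounded0D.
by apply: near0_imp (near0_and He He') => r t _ _ [-> ->]; ring.
Qed.

Lemma jetM k k0 k1 k2 l l0 l1 l2 : jet k k0 k1 k2 -> jet l l0 l1 l2 ->
  jet (fun r t => k r t * l r t) (k0 * l0) (fun t => k0 * l1 t + l0 * k1 t)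
      (fun t => k0 * l2 t + k1 t * l1 t + l0 * k2 t).
Proof.
move=> [bk1 bk2 [e be He]] [bl1 bl2 [e' be' He']].
have bc := bounded0_cst; have bv := bounded0_var.
split.
- by apply: bounded0D; apply: bounded0M.
- by apply: bounded0D; [apply: bounded0D|]; apply: bounded0M.
exists (fun r t => k0 * e' r t + k1 t * (l2 t + r * e' r t)
   + (k2 t + r * e r t) * (l1 t + r * (l2 t + r * e' r t)) + e r t * l0).
  by repeat first [apply: bounded0D | apply: bounded0M | exact: bc | exact: bv | done].
by apply: near0_imp (near0_and He He') => r t _ _ [-> ->]; ring.
Qed.

Lemma jet_comp (phi psi : R -> R) (p0 p1 p2 C d : R) k k0 k1 k2 : 0 < d ->
  (forall h, `|h| <= d -> phi (k0 + h) = p0 + h * (p1 + h * (p2 + h * psi h))) ->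
  (forall h, `|h| <= d -> `|psi h| <= C) ->
  jet k k0 k1 k2 ->
  jet (fun r t => phi (k r t)) p0 (fun t => p1 * k1 t)
    (fun t => p1 * k2 t + p2 * (k1 t * k1 t)).
Proof.
move=> dp Hphi Hpsi [bk1 bk2 [e be He]].
have bc := bounded0_cst; have bv := bounded0_var.
pose m r t := k1 t + r * (k2 t + r * e r t).
have bm : bounded0 m.
  by repeat first [apply: bounded0D | apply: bounded0M | exact: bc | exact: bv | done].
(* The expansion of [phi] is assumed only for |h| <= d; taking r <= d / (|M| + 1) keeps the
   increment r m in that range. *)
have small : near0 (fun r t => `|r * m r t| <= d).
  have [M HM] := bm.
  have dM : 0 < d / (`|M| + 1) by rewrite divr_gt0// ltr_wpDl.
  apply: near0_imp (near0_and HM (near0_le dM)) => r t r0 _ [h1 h2].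
  rewrite normrM (ger0_norm r0).
  have M1 : 0 < `|M| + 1 by rewrite ltr_wpDl.
  move: h2; rewrite ler_pdivlMr// => h2; apply: le_trans h2.
  by apply: ler_wpM2l => //; apply: (le_trans h1); rewrite (le_trans (ler_norm _))// lerDl.
split.
- by apply: bounded0M.
- by apply: bounded0D; apply: bounded0M => //; apply: bounded0M.
exists (fun r t => p1 * e r t + p2 * ((k2 t + r * e r t) * (k1 t + k1 t + r * (k2 t + r * e r t)))
   + m r t * m r t * m r t * psi (r * m r t)).
  have bpsi : bounded0 (fun r t => psi (r * m r t)).
    by exists C; apply: near0_imp small => r t _ _; exact: Hpsi.
  by repeat first [apply: bounded0D | apply: bounded0M | exact: bc | exact: bv | done].
apply: near0_imp (near0_and He small) => r t r0 Pt [-> h]; rewrite -/(m r t) Hphi//.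
by move: (psi _) => q; rewrite /m; ring.
Qed.

(** A strict inequality at the centre persists for small r, uniformly in the direction. *)
Lemma jet_gt (k : R -> T -> R) (k0 m : R) (k1 k2 : T -> R) :
  jet k k0 k1 k2 -> m < k0 -> near0 (fun r t => m < k r t).
Proof.
move=> [bk1 bk2 [e be He]] mk.
have [M HM] : bounded0 (fun r t => k1 t + r * (k2 t + r * e r t)).
  by repeat first [apply: bounded0D | apply: bounded0M | exact: bounded0_var | done].
have M1 : 0 < `|M| + 1 by rewrite ltr_wpDl.
have d0 : 0 < (k0 - m) / (2 * (`|M| + 1)) by rewrite divr_gt0 ?subr_gt0 ?mulr_gt0.
apply: near0_imp (near0_and (near0_and HM He) (near0_le d0)) => r t r0 _ [[h ->]].
rewrite ler_pdivlMr ?mulr_gt0// => hr.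
set x := k1 t + _ in h *.
have : `|r * x| <= r * (`|M| + 1).
  rewrite normrM ger0_norm// ler_wpM2l// (le_trans h)//.
  by rewrite (le_trans (ler_norm _))// lerDl.
move=> /ler_normlP[]; lra.
Qed.

End Jets.

Section Taylor.
Variable R : realType.
Implicit Types (f df : R -> R) (x y d C : R).

(** Mean value theorem between 0 and x. The order rises by one and the constant C is kept, which
    suffices to reach Taylor bounds by iteration. *)
Lemma bound_of_derivative f df n C d : f 0 = 0 ->
  (forall x, `|x| < d -> is_derive x 1 f (df x)) ->
  (forall x, `|x| < d -> `|df x| <= C * `|x| ^+ n) ->
  forall x, `|x| < d -> `|f x| <= C * `|x| ^+ n.+1.
Proof.
move=> f0 Hf Hdf x xd.
have C0 : 0 <= C * `|x| ^+ n by apply: le_trans (Hdf x xd).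
have key c : `|c| <= `|x| -> f x - f 0 = df c * (x - 0) \/ f 0 - f x = df c * (0 - x) ->
    `|f x| <= C * `|x| ^+ n.+1.
  move=> cx H.
  have E : `|f x| = `|df c| * `|x|.
    case: H; rewrite f0 ?subr0 ?sub0r.
      by move=> ->; rewrite normrM.
    by rewrite -(normrN (f x)) => ->; rewrite normrM normrN.
  rewrite E exprSr mulrA ler_wpM2r//.
  (* For x = 0 the bound [C0] may say nothing about the sign of C, so the monotonicity argument
     below does not apply. *)
  have [x0|x0] := eqVneq x 0.
    have c0 : c = 0 by apply/eqP; rewrite -normr_le0 (le_trans cx)// x0 normr0.
    by rewrite c0 x0; apply: Hdf; rewrite -x0.
  apply: (le_trans (Hdf c (le_lt_trans cx xd))).
  have Cp : 0 <= C.
    by move: C0; rewrite pmulr_lge0// exprn_gt0// normr_gt0.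
  by apply: ler_wpM2l => //; apply: lerXn2r.
have [x0|x0] := leP 0 x.
  have [| |c cx Ec] := @MVT_segment R f df 0 x x0.
  - move=> z; rewrite in_itv/= => /andP[z0 zx]; apply: Hf.
    by move: xd; rewrite !ger0_norm ?(ltW z0)// => /(lt_trans zx).
  - apply: derivable_within_continuous => z; rewrite in_itv/= => /andP[z0 zx].
    have [] := Hf z _ => //.
    by move: xd; rewrite !ger0_norm// => /(le_lt_trans zx).
  apply: (key c); last by left.
  by move: cx; rewrite in_itv/= => /andP[c0 cx]; rewrite !ger0_norm.
have [| |c cx Ec] := @MVT_segment R f df x 0 (ltW x0).
- move=> z; rewrite in_itv/= => /andP[z0 zx]; apply: Hf.
  by move: xd; rewrite !ler0_norm ?(ltW zx)// ?(ltW x0)//; apply: lt_trans; rewrite ltrN2.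
- apply: derivable_within_continuous => z; rewrite in_itv/= => /andP[z0 zx].
  have [] := Hf z _ => //.
  by move: xd; rewrite !ler0_norm// ?(ltW x0)//; apply: le_lt_trans; rewrite lerN2.
apply: (key c); last by right.
by move: cx; rewrite in_itv/= => /andP[c0 cx]; rewrite !ler0_norm ?lerN2// ltW.
Qed.

(** The derivative of each Taylor remainder of exp is the preceding remainder, so the bound of exp
    by [expR 1] on |z| < 1 is integrated three times. *)
Lemma expR_taylor2 x : `|x| < 1 ->
  `|expR x - 1 - x - x ^+ 2 / 2| <= expR 1 * `|x| ^+ 3.
Proof.
have B0 (z : R) : `|z| < 1 -> `|expR z| <= expR 1 * `|z| ^+ 0.
  move=> z1; rewrite expr0 mulr1 ger0_norm ?expR_ge0//.
  by rewrite ler_expR (le_trans (ler_norm z))// ltW.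
have B1 := @bound_of_derivative (fun z => expR z - 1) expR 0 (expR 1) 1.
have B2 := @bound_of_derivative (fun z => expR z - 1 - z) (fun z => expR z - 1) 1 (expR 1) 1.
have B3 := @bound_of_derivative (fun z => expR z - 1 - z - z ^+ 2 / 2)
   (fun z => expR z - 1 - z) 2 (expR 1) 1.
have {}B1 : forall z : R, `|z| < 1 -> `|expR z - 1| <= expR 1 * `|z| ^+ 1.
  apply: B1 => //; first by rewrite expR0; ring.
  by move=> z _; apply: is_derive_eq; rewrite /GRing.scale/=; ring.
have {}B2 : forall z : R, `|z| < 1 -> `|expR z - 1 - z| <= expR 1 * `|z| ^+ 2.
  apply: B2 => //; first by rewrite expR0; ring.
  by move=> z _; apply: is_derive_eq; rewrite /GRing.scale/=; ring.
apply: B3 => //; first by rewrite expR0; ring.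
by move=> z _; apply: is_derive_eq; rewrite /GRing.scale/=; field.
Qed.

Lemma ln_taylor2 x : `|x| < 2^-1 -> `|ln (1 + x) - x + x ^+ 2 / 2| <= 2 * `|x| ^+ 3.
Proof.
apply: (@bound_of_derivative (fun z => ln (1 + z) - z + z ^+ 2 / 2)
  (fun z => (1 + z)^-1 - 1 + z) 2).
- by rewrite addr0 ln1; ring.
- move=> z /ltr_normlP[z1 z2].
  have p : 0 < 1 + z by lra.
  have h := is_derive1_ln p.
  apply: is_derive_eq; rewrite /GRing.scale/=; field.
  by rewrite gt_eqF.
move=> z /ltr_normlP[z1 z2].
have p : 0 < 1 + z by lra.
have -> : (1 + z)^-1 - 1 + z = z ^+ 2 / (1 + z) by field; rewrite gt_eqF.
rewrite normrM normrX mulrC ler_wpM2r// ?exprn_ge0//.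
by rewrite normfV ger0_norm ?(ltW p)// invf_ple ?posrE//; lra.
Qed.

End Taylor.

Section JetsOfFunctions.
Variables (R : realType) (T : Type) (P : T -> Prop).
Notation jet := (jet P).

Lemma jet_exp k (k1 k2 : T -> R) : jet k 0 k1 k2 ->
  jet (fun r t => expR (k r t)) 1 k1 (fun t => k2 t + k1 t * k1 t / 2).
Proof.
move=> Hk.
(* At h = 0 the quotient is 0 by the convention on division, and the expansion holds there
   trivially. *)
pose psi (h : R) := (expR h - 1 - h - h ^+ 2 / 2) / h ^+ 3.
have h0 : (0 : R) < 2^-1 by rewrite invr_gt0.
apply: jet_ext (jet_comp (phi := expR) (psi := psi) (p0 := 1) (p1 := 1) (p2 := 2^-1) h0 _
  (C := expR 1) _ Hk) _ _ _ _ => //.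
- move=> h _; rewrite add0r /psi; have [->|hn0] := eqVneq h 0.
    by rewrite expR0; ring.
  by field.
- move=> h hd; have h1 : `|h| < 1 by apply: le_lt_trans hd _; lra.
  rewrite /psi; have [->|hn0] := eqVneq h 0.
    by rewrite !expr0n/= invr0 mulr0 normr0 expR_ge0.
  rewrite normrM normfV normrX ler_pdivrMr ?exprn_gt0 ?normr_gt0//.
  exact: expR_taylor2.
- by move=> t; rewrite mul1r.
- by move=> t; field.
Qed.

Lemma jet_ln k (k1 k2 : T -> R) : jet k 1 k1 k2 ->
  jet (fun r t => ln (k r t)) 0 k1 (fun t => k2 t - k1 t * k1 t / 2).
Proof.
move=> Hk.
pose psi (h : R) := (ln (1 + h) - h + h ^+ 2 / 2) / h ^+ 3.
have h0 : (0 : R) < 4^-1 by rewrite invr_gt0.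
apply: jet_ext (jet_comp (phi := @ln R) (psi := psi) (p0 := 0) (p1 := 1) (p2 := - 2^-1) h0 _
  (C := 2) _ Hk) _ _ _ _ => //.
- move=> h _; rewrite /psi; have [->|hn0] := eqVneq h 0.
    by rewrite addr0 ln1; ring.
  by field.
- move=> h hd; have h1 : `|h| < 2^-1 by apply: le_lt_trans hd _; lra.
  rewrite /psi; have [->|hn0] := eqVneq h 0.
    by rewrite !expr0n/= invr0 mulr0 normr0.
  rewrite normrM normfV normrX ler_pdivrMr ?exprn_gt0 ?normr_gt0//.
  exact: ln_taylor2.
- by move=> t; rewrite mul1r.
- by move=> t; field.
Qed.

Lemma jet_inv k (k1 k2 : T -> R) : jet k 1 k1 k2 ->
  jet (fun r t => (k r t)^-1) 1 (fun t => - k1 t) (fun t => k1 t * k1 t - k2 t).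
Proof.
move=> Hk.
(* The exact identity is 1 / (1 + h) = 1 - h + h^2 - h^3 / (1 + h). *)
pose psi (h : R) := - (1 + h)^-1.
have h0 : (0 : R) < 2^-1 by rewrite invr_gt0.
apply: jet_ext (jet_comp (phi := fun x => x^-1) (psi := psi) (p0 := 1) (p1 := - 1) (p2 := 1) h0 _
  (C := 2) _ Hk) _ _ _ _ => //.
- move=> h /ler_normlP[h1 h2]; rewrite /psi; field.
  by rewrite gt_eqF//; lra.
- move=> h /ler_normlP[h1 h2]; rewrite /psi normrN normfV.
  have p : 0 < 1 + h by lra.
  by rewrite ger0_norm ?(ltW p)// invf_ple ?posrE//; lra.
- by move=> t; rewrite mulN1r.
- by move=> t; ring.
Qed.

End JetsOfFunctions.

(** * Circle means *)

Section CircleMeans.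
Variable R : realType.

(* No measurability is needed: the integral of [v] is the difference of two
   suprema over simple functions. *)
Lemma le_integral_nomeas d (T : measurableType d) (mu : {measure set T -> \bar R})
    (D : set T) (f g : T -> \bar R) : (forall x, D x -> (f x <= g x)%E) ->
  (\int[mu]_(x in D) f x <= \int[mu]_(x in D) g x)%E.
Proof.
move=> fg.
have mono (h k : T -> \bar R) : (forall x, D x -> (0 <= h x)%E) ->
    (forall x, D x -> (h x <= k x)%E) ->
    (\int[mu]_(x in D) h x <= \int[mu]_(x in D) k x)%E.
  move=> h0 hk; rewrite !ge0_integralE//; last first.
    by move=> x Dx; apply: le_trans (hk x Dx); exact: h0.
  apply: le_ereal_sup => _ [w wh <-]; exists w => //= x.
  by apply: le_trans (wh x) _; apply: lee_restrict.
rewrite integralE [leRHS]integralE; apply: leeB; apply: mono => // x Dx.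
- by apply: (funepos_le (D := [set x])) (mem_set _) => // z /set_mem ->; exact: fg.
- by apply: (funeneg_le (D := [set x])) (mem_set _) => // z /set_mem ->; exact: fg.
Qed.

Lemma integral_trig (a b c p q s : R) :
  (\int[lebesgue_measure]_(theta in `[0%R, (2 * pi)%R])
     (a + b * cos theta + c * sin theta + p * cos theta ^+ 2
       + q * (cos theta * sin theta) + s * sin theta ^+ 2)%:E
   = (2 * pi * (a + (p + s) / 2))%:E)%E.
Proof.
pose F (x : R) := a * x + b * sin x - c * cos x + p * ((x + sin x * cos x) / 2)
  + q * (sin x ^+ 2 / 2) + s * ((x - sin x * cos x) / 2).
have dF (x : R) : is_derive x 1 F (a + b * cos x + c * sin x + p * cos x ^+ 2
       + q * (cos x * sin x) + s * sin x ^+ 2).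
  rewrite /F; apply: is_derive_eq; rewrite /GRing.scale/=.
  (* The added multiple of 1 - (cos^2 + sin^2) is what separates the derivative of the primitive
     from the integrand, leaving a rational identity. *)
  transitivity (a + b * cos x + c * sin x + p * cos x ^+ 2
       + q * (cos x * sin x) + s * sin x ^+ 2
       + (p + s) / 2 * (1 - (cos x ^+ 2 + sin x ^+ 2))); first by field.
  by rewrite cos2Dsin2 subrr mulr0 addr0.
have cF (x : R) : {for x, continuous F}.
  by apply: differentiable_continuous; apply/derivable1_diffP; have [] := dF x.
rewrite (@continuous_FTC2 _ _ F).
- rewrite -EFinB; congr EFin; rewrite /F.
  have -> : cos (2 * pi : R) = 1 by rewrite mulr_natl cos2pi.
  have -> : sin (2 * pi : R) = 0 by rewrite mulr_natl sin2pi.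
  by rewrite sin0 cos0; field.
- by rewrite mulr_gt0 ?pi_gt0.
- apply: continuous_subspaceT => x; apply: differentiable_continuous.
  by apply/derivable1_diffP; exact: ex_derive.
- split.
  + by move=> x _; have [] := dF x.
  + by apply: cvg_at_right_filter; exact: cF.
  + by apply: cvg_at_left_filter; exact: cF.
- by move=> x _; rewrite derive1E; have [_ ->] := dF x.
Qed.
End CircleMeans.

Section JetMean.
Variable R : realType.

(** The square contains all directions (cos theta, sin theta), and its multiple by a single r is
    already a full neighbourhood of 0, which is used to keep a disc inside the shell. *)
Definition unit_square (w : R * R) := `|w.1| <= 1 /\ `|w.2| <= 1.

Definition jet_at0 (K : R -> R -> R) (k0 : R) (k1 k2 : R * R -> R) : Prop :=
  jet unit_square (fun r w => K (r * w.1) (r * w.2)) k0 k1 k2.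

(** Linear and mixed terms have mean 0 over the circle and each square has mean 1/2, so the mean of
    K exceeds [k0] by r^2 (p + s) / 2 up to O(r^3); p + s is half the Laplacian of K at 0. The gain
    e is fixed before v, hence serves every v below m - k K on the circle. *)
Lemma jet_circle_mean (K : R -> R -> R) (k0 a b p q s : R) : 0 < p + s ->
  jet_at0 K k0 (fun w => a * w.1 + b * w.2)
    (fun w => p * w.1 ^+ 2 + q * (w.1 * w.2) + s * w.2 ^+ 2) ->
  exists2 d : R, 0 < d & forall r, 0 < r <= d -> exists2 e : R, 0 < e &
    forall (v : R[i]^o -> \bar R) (c : R[i]^o) (m k : R), 0 < k ->
    (forall theta, (v ((c : R[i]) + r%:C * (cos theta +i* sin theta))%R
       <= (m - k * K (r * cos theta) (r * sin theta))%:E)%E) ->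
    (circle_mean v c r <= (m - k * (k0 + e))%:E)%E.
Proof.
move=> ps [_ _ [rem [C HC] HK]].
have Cp : 0 < `|C| + 1 by rewrite ltr_wpDl.
(* For r up to this bound the cubic remainder takes at most half of the gain r^2 (p + s) / 2. *)
have dp : 0 < (p + s) / (4 * (`|C| + 1)) by rewrite divr_gt0 ?mulr_gt0.
have [d d0 Hd] := near0_and (near0_and HC HK) (near0_le unit_square dp).
exists d => // r /andP[r0 rd].
have pi2 : 0 < 2 * pi :> R by rewrite mulr_gt0 ?pi_gt0.
have low theta : k0 + r * (a * cos theta + b * sin theta)
    + r ^+ 2 * (p * cos theta ^+ 2 + q * (cos theta * sin theta) + s * sin theta ^+ 2)
    - (`|C| + 1) * r ^+ 3 <= K (r * cos theta) (r * sin theta).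
  have Pt : unit_square (cos theta, sin theta).
    by split; rewrite /= ler_norml ?cos_geN1 ?cos_le1 ?sin_geN1 ?sin_le1.
  have rd' : 0 <= r <= d by rewrite ltW.
  have [[h1 ->] _] := Hd r _ rd' Pt.
  rewrite /=; set e := rem _ _ in h1 *.
  have : - (`|C| + 1) <= e.
    rewrite lerNl (le_trans (ler_norm (- e)))// normrN (le_trans h1)//.
    by rewrite (le_trans (ler_norm _))// lerDl.
  move=> /(ler_wpM2l (exprn_ge0 3 (ltW r0))).
  lra.
have rs : r * (`|C| + 1) <= (p + s) / 4.
  have P0 : unit_square (0, 0) by split; rewrite /= normr0 ler01.
  have [_] := Hd r (0, 0) (introT andP (conj (ltW r0) rd)) P0.
  by rewrite ler_pdivlMr ?mulr_gt0//; lra.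
exists (r ^+ 2 * ((p + s) / 2) - (`|C| + 1) * r ^+ 3).
  have -> : r ^+ 2 * ((p + s) / 2) - (`|C| + 1) * r ^+ 3
     = r ^+ 2 * ((p + s) / 2 - r * (`|C| + 1)) by ring.
  by rewrite mulr_gt0 ?exprn_gt0//; lra.
move=> v c m k k0p Hv.
pose A := m - k * (k0 - (`|C| + 1) * r ^+ 3).
have := integral_trig A (- k * r * a) (- k * r * b) (- k * r ^+ 2 * p) (- k * r ^+ 2 * q)
  (- k * r ^+ 2 * s).
rewrite /circle_mean; set I := integral _ _ _ => EI.
set I' := integral _ _ _.
have II' : (I' <= I)%E.
  apply: le_integral_nomeas => theta _; apply: le_trans (Hv theta) _.
  rewrite lee_fin /A; have := ler_wpM2l (ltW k0p) (low theta); lra.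
apply: (@le_trans _ _ (((2 * pi)^-1)%:E * I)%E).
  by apply: lee_wpmul2l => //; rewrite lee_fin invr_ge0 ltW.
rewrite EI -EFinM lee_fin /A mulrA mulVf ?gt_eqF// mul1r; lra.
Qed.
End JetMean.

(** * The barrier along a holomorphic disc *)

Section Barrier.
Variable R : realType.
Implicit Types (x y E A c Z b : R) (w : R * R).

(* V = dbar_re + i dbar_im solves d V / d conj zeta = conj V
   with V(0) = 1 and d V / d zeta (0) = b1 + i b2. *)
Definition dbar_re (b1 b2 x y : R) : R := (1 + b1) / 2 * expR (2 * x)
  + ((1 - b1 + b2) / 4 * expR (- 2 * y) + (1 - b1 - b2) / 4 * expR (2 * y)).
Definition dbar_im (b1 b2 x y : R) : R := - b2 / 2 * expR (- 2 * x)
  + ((1 - b1 + b2) / 4 * expR (- 2 * y) - (1 - b1 - b2) / 4 * expR (2 * y)).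

(* At a point of C^2 with z1 = X1 + i X2, t = log (rho / |z2|) and
   C2 + i S2 = z2 / conj z2. The middle term, Re (z1 z2 / conj z2), keeps the
   coefficient of |d u2 / d zeta|^2 in the Levi form positive where the mixed
   term could vanish; the last one restores the sign on the boundary. *)
Definition barrier (E A c X1 X2 t C2 S2 : R) : R :=
  (E - X1 ^+ 2 - X2 ^+ 2) * (A * t - c * t ^+ 2) + c * (X1 * C2 - X2 * S2) - c.

Definition disc_barrier (E A c t0 Z1 Z2 b1 b2 x y : R) : R :=
  let a := dbar_re b1 b2 x y in let b := dbar_im b1 b2 x y in
  let n := a ^+ 2 + b ^+ 2 in
  barrier E A c (Z1 + x) (Z2 + y) (t0 - ln n / 2) ((a ^+ 2 - b ^+ 2) / n) (2 * a * b / n).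

Notation J := (jet (@unit_square R)).

Lemma jet_scale (a : R) k k0 k1 k2 : J k k0 k1 k2 ->
  J (fun r t => a * k r t) (a * k0) (fun t => a * k1 t) (fun t => a * k2 t).
Proof.
move=> Hk; have H := jetM (jet_cst (@unit_square R) a) Hk.
apply: (jet_ext H) => // t; ring.
Qed.

Lemma bounded0_fst : bounded0 (@unit_square R) (fun _ w => w.1).
Proof. by exists 1; apply: near0_true => r t _ []. Qed.

Lemma bounded0_snd : bounded0 (@unit_square R) (fun _ w => w.2).
Proof. by exists 1; apply: near0_true => r t _ []. Qed.

Lemma jet_expx (a : R) : J (fun r w => expR (a * (r * w.1))) 1
  (fun w => a * w.1) (fun w => a ^+ 2 / 2 * w.1 ^+ 2).
Proof.
have H := jet_scale a (jet_lin bounded0_fst).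
apply: jet_ext (jet_exp (jet_ext H _ _ _ _)) _ _ _ _; try (move=> *; reflexivity).
- by rewrite mulr0.
- by move=> t /=; field.
Qed.

Lemma jet_expy (a : R) : J (fun r w => expR (a * (r * w.2))) 1
  (fun w => a * w.2) (fun w => a ^+ 2 / 2 * w.2 ^+ 2).
Proof.
have H := jet_scale a (jet_lin bounded0_snd).
apply: jet_ext (jet_exp (jet_ext H _ _ _ _)) _ _ _ _; try (move=> *; reflexivity).
- by rewrite mulr0.
- by move=> t /=; field.
Qed.

Lemma jet_dbar_re b1 b2 : jet_at0 (dbar_re b1 b2) 1
  (fun w => (1 + b1) * w.1 - b2 * w.2)
  (fun w => (1 + b1) * w.1 ^+ 2 + (1 - b1) * w.2 ^+ 2).
Proof.
apply: jet_ext (jetD (jet_scale ((1 + b1) / 2) (jet_expx 2))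
 (jetD (jet_scale ((1 - b1 + b2) / 4) (jet_expy (- 2)))
   (jet_scale ((1 - b1 - b2) / 4) (jet_expy 2)))) _ _ _ _.
- by move=> r w; rewrite /dbar_re.
- by field.
- by move=> w; field.
- by move=> w; field.
Qed.

Lemma jet_dbar_im b1 b2 : jet_at0 (dbar_im b1 b2) 0
  (fun w => b2 * w.1 + (b1 - 1) * w.2)
  (fun w => - b2 * w.1 ^+ 2 + b2 * w.2 ^+ 2).
Proof.
apply: jet_ext (jetD (jet_scale (- b2 / 2) (jet_expx (- 2)))
 (jetD (jet_scale ((1 - b1 + b2) / 4) (jet_expy (- 2)))
   (jet_scale (- ((1 - b1 - b2) / 4)) (jet_expy 2)))) _ _ _ _.
- by move=> r w; rewrite /dbar_im; field. 
- by field.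
- by move=> w; field.
- by move=> w; field.
Qed.

Lemma jet_sqn_dbar b1 b2 :
  let a1 w := (1 + b1) * w.1 - b2 * w.2 in
  let a2 w := (1 + b1) * w.1 ^+ 2 + (1 - b1) * w.2 ^+ 2 in
  let e1 w := b2 * w.1 + (b1 - 1) * w.2 in
  jet_at0 (fun x y => dbar_re b1 b2 x y ^+ 2 + dbar_im b1 b2 x y ^+ 2) 1
    (fun w => 2 * a1 w) (fun w => 2 * a2 w + a1 w ^+ 2 + e1 w ^+ 2).
Proof.
move=> a1 a2 e1.
have Ja := jet_dbar_re b1 b2; have Jb := jet_dbar_im b1 b2.
by apply: jet_ext (jetD (jetM Ja Ja) (jetM Jb Jb)) _ _ _ _; move=> *;
  rewrite /a1 /a2 /e1; ring.
Qed.

(** Summed over the two axes, the second-order coefficient of log |V| is 2 - 2 b1: the terms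
    quadratic in b cancel, as log |V| would be harmonic for holomorphic V. The free parameter b thus
    bends the height linearly. *)
Lemma jet_height b1 b2 (t0 : R) :
  let a1 w := (1 + b1) * w.1 - b2 * w.2 in
  let a2 w := (1 + b1) * w.1 ^+ 2 + (1 - b1) * w.2 ^+ 2 in
  let e1 w := b2 * w.1 + (b1 - 1) * w.2 in
  jet_at0 (fun x y => t0 - ln (dbar_re b1 b2 x y ^+ 2 + dbar_im b1 b2 x y ^+ 2) / 2) t0
    (fun w => - a1 w) (fun w => - a2 w - (e1 w ^+ 2 - a1 w ^+ 2) / 2).
Proof.
move=> a1 a2 e1.
apply: jet_ext (jetD (jet_cst (@unit_square R) t0)
  (jet_scale (- 2^-1) (jet_ln (jet_sqn_dbar b1 b2)))) _ _ _ _.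
- by move=> r w; rewrite mulNr mulrC.
- by rewrite mulr0 addr0.
- by move=> w; rewrite /a1; field.
- by move=> w; rewrite /a1 /a2 /e1; field.
Qed.

(** [f] and [d] are the value and the slope at [t0] of the profile A t - c t^2; a1 + i e1 and a2 + i
    e2 are the first- and second-order parts of V. The term in a1^2 with factor - g c comes from the
    concavity of the profile and - 2 c Z1 e1^2 from Re (z1 z2 / conj z2); together they produce the
    coefficient - c (Z1 + g/2) of |b|^2. *)
Lemma jet_disc_barrier E A c (t0 : R) Z1 Z2 b1 b2 :
  let d := A - 2 * c * t0 in
  let f := A * t0 - c * t0 ^+ 2 in
  let g := E - Z1 ^+ 2 - Z2 ^+ 2 in
  let a1 w := (1 + b1) * w.1 - b2 * w.2 in
  let a2 w := (1 + b1) * w.1 ^+ 2 + (1 - b1) * w.2 ^+ 2 in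
  let e1 w := b2 * w.1 + (b1 - 1) * w.2 in
  let e2 w := - b2 * w.1 ^+ 2 + b2 * w.2 ^+ 2 in
  jet_at0 (disc_barrier E A c t0 Z1 Z2 b1 b2) (barrier E A c Z1 Z2 t0 1 0)
  (fun w => - g * d * a1 w - 2 * (Z1 * w.1 + Z2 * w.2) * f
      + c * (w.1 - 2 * Z2 * e1 w))
  (fun w => - g * (d * (a2 w + (e1 w ^+ 2 - a1 w ^+ 2) / 2) + c * a1 w ^+ 2)
     + 2 * (Z1 * w.1 + Z2 * w.2) * d * a1 w - (w.1 ^+ 2 + w.2 ^+ 2) * f
     + c * (- 2 * Z1 * e1 w ^+ 2 - 2 * Z2 * (e2 w - a1 w * e1 w) - 2 * w.2 * e1 w)).
Proof.
move=> d f g a1 a2 e1 e2.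
have Ja := jet_dbar_re b1 b2; have Jb := jet_dbar_im b1 b2.
rewrite /jet_at0 -/a1 -/a2 -/e1 -/e2 in Ja Jb.
have Jaa := jetM Ja Ja; have Jbb := jetM Jb Jb; have Jab := jetM Ja Jb.
have Jn := jet_sqn_dbar b1 b2; have Jt := jet_height b1 b2 t0.
rewrite /jet_at0 /= in Jn Jt.
have Jtt := jetM Jt Jt.
have Jf := jetD (jet_scale A Jt) (jet_scale (- c) Jtt).
have Jx := jetD (jet_cst (@unit_square R) Z1) (jet_lin bounded0_fst).
have Jy := jetD (jet_cst (@unit_square R) Z2) (jet_lin bounded0_snd).
have Jg := jetD (jet_cst (@unit_square R) E) (jet_scale (- 1) (jetD (jetM Jx Jx) (jetM Jy Jy))).
have Jv := jet_inv Jn.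
have JC := jetM (jetD Jaa (jet_scale (- 1) Jbb)) Jv.
have JS := jetM (jet_scale 2 Jab) Jv.
have Jp := jetD (jetM Jx JC) (jet_scale (- 1) (jetM Jy JS)).
apply: jet_ext (jetD (jetD (jetM Jg Jf) (jet_scale c Jp)) (jet_cst (@unit_square R) (- c))) _ _ _ _.
- move=> r w; rewrite /disc_barrier /barrier.
  set a := dbar_re _ _ _ _; set b := dbar_im _ _ _ _.
  by move: (ln _) ((a ^+ 2 + b ^+ 2)^-1) => l v; field.
- by rewrite /barrier; field.
- by move=> w; rewrite /f /d /g /a1 /a2 /e1 /e2 /=; field.
- by move=> w; rewrite /f /d /g /a1 /a2 /e1 /e2 /=; field.
Qed.

End Barrier.

(** * Choice of the derivative b of the disc *)

Section Direction.
Variable R : realType.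

(** Take |N| = 8/k + 1 with the sign of Y: then N^2 k >= 8 + k, which beats B. *)
Lemma exists_quadratic_pos (k Y B : R) : 0 < k -> - 8 <= B ->
  exists N : R, 0 < N ^+ 2 * k + N * Y + B.
Proof.
move=> k0 B8.
pose N := 8 / k + 1.
have kN : k * N = 8 + k by rewrite /N; field; rewrite gt_eqF.
have N1 : 1 <= N by rewrite /N lerDr divr_ge0// ltW.
have kNN : 8 < N ^+ 2 * k.
  have : (8 + k) * 1 <= (8 + k) * N by rewrite ler_wpM2l//; lra.
  rewrite -kN; move: (N) kN N1 => n; lra.
clearbody N; have N0 : 0 <= N by lra.
have [y|y] := leP 0 Y.
  by exists N; have := mulr_ge0 N0 y; lra.
have y' : 0 <= - Y by rewrite oppr_ge0 ltW.
by exists (- N); have := mulr_ge0 N0 y'; lra.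
Qed.

(** The mixed term is Re (b Y). With b = conj Y / (4 c) the two terms in b sum to at least (1/4 -
    1/16) |Y|^2 / c, more than 14 by the lower bound on Y, which beats B >= -8. *)
Lemma exists_hermitian_pos (c h Y1 Y2 B : R) :
  0 < c -> h <= 1 -> - 8 <= B -> 78 * c <= Y1 ^+ 2 + Y2 ^+ 2 ->
  exists b1 b2 : R, 0 < (b1 ^+ 2 + b2 ^+ 2) * - (c * h) + (b1 * Y1 - b2 * Y2) + B.
Proof.
move=> c0 h1 B8 Ybig.
pose y := (Y1 ^+ 2 + Y2 ^+ 2) / c.
have y78 : 78 <= y by rewrite ler_pdivlMr.
exists (Y1 / (4 * c)), (- Y2 / (4 * c)).
have -> : ((Y1 / (4 * c)) ^+ 2 + (- Y2 / (4 * c)) ^+ 2) * - (c * h)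
   + (Y1 / (4 * c) * Y1 - - Y2 / (4 * c) * Y2) = y / 4 - y * h / 16.
  by rewrite /y; field; rewrite gt_eqF.
clearbody y; have : y * h <= y * 1 by rewrite ler_wpM2l//; lra.
by lra.
Qed.

(** The main part of the mixed coefficient is d (Z + g). Since |Z + g|^2 = |Z|^2 + 2 g (Z1 + g/2),
    the sign hypothesis gives |Z + g| >= E/4: either |Z|^2 >= E/2, or g >= E/2 and Z1 + g >= g/2. As
    d >= i/2, the square is of order i^2 E^2, hence large against c = s i^2. *)
Lemma cross_term_big (i s E c d g Z1 Z2 : R) :
  0 < i -> c = s * i ^+ 2 -> 0 < s -> i ^+ 2 <= 1 -> 0 < E <= 1 ->
  200 * (100 * s) <= E ^+ 2 -> i / 2 <= d -> E = g + Z1 ^+ 2 + Z2 ^+ 2 ->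
  0 < g <= 1 -> 0 <= Z1 + g / 2 -> - 1 <= Z1 <= 1 -> Z2 ^+ 2 <= 1 ->
  78 * c <= (d * (Z1 + g) - c * (1 + g) + 2 * c * Z1) ^+ 2 + (d * Z2 - 2 * c * Z2) ^+ 2.
Proof.
move=> i0 cE s0 i1 /andP[E0 E1] sE d2 gE /andP[g0 g1] h /andP[nZ1 pZ1] Z2s.
have EE : E ^+ 2 <= E by rewrite expr2 ler_piMl// ltW.
have -> : d * (Z1 + g) - c * (1 + g) + 2 * c * Z1
  = d * (Z1 + g) + c * (2 * Z1 - (1 + g)) by ring.
have -> : d * Z2 - 2 * c * Z2 = d * Z2 + c * (- 2 * Z2) by ring.
have lowZ : E ^+ 2 / 16 <= (Z1 + g) ^+ 2 + Z2 ^+ 2.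
  have e1 : (Z1 + g) ^+ 2 + Z2 ^+ 2 = Z1 ^+ 2 + Z2 ^+ 2 + 2 * (g * (Z1 + g / 2)) by field.
  have e2 : 0 <= g * (Z1 + g / 2) by rewrite mulr_ge0// ltW.
  have [e3|e3] := leP (E / 2) (Z1 ^+ 2 + Z2 ^+ 2).
    by rewrite e1; clear -e2 e3 EE E0; lra.
  have ge : E / 2 <= g by clear -gE e3; lra.
  have : (E / 4) ^+ 2 <= (Z1 + g) ^+ 2.
    by rewrite ler_sqr ?nnegrE; clear -ge h E0; lra.
  by have := sqr_ge0 Z2; rewrite expr_div_n; clear; lra.
have dd : i ^+ 2 / 4 <= d ^+ 2.
  have -> : i ^+ 2 / 4 = (i / 2) ^+ 2 by field.
  by rewrite ler_sqr ?nnegrE; clear -i0 d2; lra.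
have cc : c ^+ 2 <= s * E ^+ 2 * i ^+ 2 / 200 / 100.
  have -> : c ^+ 2 = s * i ^+ 2 * (s * i ^+ 2) by rewrite cE; ring.
  have -> : s * E ^+ 2 * i ^+ 2 / 200 / 100 = s * i ^+ 2 * (E ^+ 2 / 200 / 100) by field.
  apply: ler_wpM2l; first by rewrite mulr_ge0 ?sqr_ge0// ltW.
  have : s * i ^+ 2 <= s by rewrite ler_piMr// ltW.
  by clear -sE; lra.
(* Half the square of the main part survives; the corrections of order c cost at most 20 c^2. *)
have low (u' v : R) : u' ^+ 2 / 2 - v ^+ 2 <= (u' + v) ^+ 2.
  by have := sqr_ge0 (u' + 2 * v); clear; lra.
have lY1 := low (d * (Z1 + g)) (c * (2 * Z1 - (1 + g))).
have lY2 := low (d * Z2) (c * (- 2 * Z2)).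
have w1 : (2 * Z1 - (1 + g)) ^+ 2 <= 16.
  have -> : 16 = 4 ^+ 2 :> R by ring.
  rewrite -[leLHS]real_normK ?num_real// ler_sqr ?nnegrE// ler_norml.
  by clear -nZ1 pZ1 g0 g1; lra.
have w2 : (- 2 * Z2) ^+ 2 <= 4 by clear -Z2s; lra.
have m1 := ler_wpM2l (sqr_ge0 c) w1.
have m2 := ler_wpM2l (sqr_ge0 c) w2.
have m3 : i ^+ 2 / 4 * (E ^+ 2 / 16) <= d ^+ 2 * ((Z1 + g) ^+ 2 + Z2 ^+ 2).
  by apply: ler_pM dd lowZ; rewrite divr_ge0 ?sqr_ge0.
have m4 : i ^+ 2 * (200 * (100 * s)) <= i ^+ 2 * E ^+ 2 by rewrite ler_wpM2l// sqr_ge0.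
have e5 : s * 100 <= 1 by clear -sE EE E1 s0; lra.
have m5 := ler_wpM2r (mulr_ge0 (sqr_ge0 E) (sqr_ge0 i)) e5.
have m6 := mulr_ge0 (sqr_ge0 E) (sqr_ge0 i).
rewrite [X in X <= _](_ : _ = 78 * (s * i ^+ 2)); last by rewrite cE.
clear -m6 lY1 lY2 m1 m2 m3 m4 m5 cc; lra.
Qed.

(* The expression is a quarter of the Laplacian of [disc_barrier] at 0. *)
Lemma levi_form_pos (E L s t0 Z1 Z2 : R) (c := s / L ^+ 2) (A := (1 + s) / L)
    (d := A - 2 * c * t0) (f := A * t0 - c * t0 ^+ 2)
    (g := E - Z1 ^+ 2 - Z2 ^+ 2) :
  0 < E <= 1 -> 1 <= L -> 0 < s -> 200 * (100 * s) <= E ^+ 2 -> 0 <= t0 <= L -> 0 < g ->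
  exists b1 b2 : R, 0 < (b1 ^+ 2 + b2 ^+ 2) * - (c * (Z1 + g / 2))
    + (b1 * (d * (Z1 + g) - c * (1 + g) + 2 * c * Z1) - b2 * (d * Z2 - 2 * c * Z2))
    + (- f + (d - c) * Z1 - g * (c / 2 + d) + c).
Proof.
move=> /andP[E0 E1] L1 s0 sE /andP[t00 tL] g0.
have L0 : 0 < L by lra.
have EE : E ^+ 2 <= E by rewrite expr2 ler_piMl// ltW.
have s1 : 100 * s <= 1 by lra.
(* With i = 1/L and u = t0/L the profile becomes u (1 + s - s u), free of L, while its slope is of
   order i and c = s i^2. *)
pose i := L^-1.
have i0 : 0 < i by rewrite invr_gt0.
have i1 : i <= 1 by rewrite invf_le1.
have iL : i * L = 1 by rewrite mulVf// gt_eqF.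
have cE : c = s * i ^+ 2 by rewrite /c exprVn.
have c0 : 0 < c by rewrite cE mulr_gt0// exprn_gt0.
have ii : i ^+ 2 <= i by rewrite expr2 ler_piMl// ltW.
have ci : c <= s * i by rewrite cE ler_pM2l.
have cs : c <= s by rewrite (le_trans ci)// ler_piMr// ltW.
pose u := i * t0.
have u0 : 0 <= u by rewrite mulr_ge0// ltW.
have u1 : u <= 1 by rewrite -iL ler_pM2l.
have dE : d = i * (1 + s - 2 * s * u) by rewrite /d /A cE /u /i; ring.
have fE : f = u * (1 + s - s * u) by rewrite /f /A cE /u /i; ring.
have gE : E = g + Z1 ^+ 2 + Z2 ^+ 2 by rewrite /g; ring.
clearbody g f d A c u i.
have su : s * u <= s by rewrite ler_piMr// ltW.
have su0 : 0 <= s * u by rewrite mulr_ge0// ltW.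
have d2 : i / 2 <= d by rewrite dE ler_pM2l//; lra.
have d1 : d <= 2.
  rewrite dE (@le_trans _ _ (1 * (1 + s - 2 * s * u)))// ?ler_wpM2r//;
    by clear -su su0 s1 s0; lra.
have d0 : 0 < d by apply: lt_le_trans d2; rewrite divr_gt0.
have f2 : f <= 2.
  rewrite fE (@le_trans _ _ (1 * (1 + s - s * u)))// ?ler_wpM2r//;
    by clear -su su0 s1 s0; lra.
have Z1s : Z1 ^+ 2 <= 1 by have := sqr_ge0 Z2; clear -gE g0 E1; lra.
have Z2s : Z2 ^+ 2 <= 1 by have := sqr_ge0 Z1; clear -gE g0 E1; lra.
have /ler_normlP[nZ1 pZ1] : `|Z1| <= 1 by rewrite -(@expr_le1 _ 2)// real_normK// num_real.
have g1 : g <= 1 by have := sqr_ge0 Z1; have := sqr_ge0 Z2; clear -gE E1; lra.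
have A0 : - 8 <= - f + (d - c) * Z1 - g * (c / 2 + d) + c.
  have h1 : - 2 <= (d - c) * Z1.
    have : `|(d - c) * Z1| <= 2.
      rewrite normrM -[leRHS]mulr1 ler_pM//; first by rewrite ler_norml; clear -d0 d1 c0 cs s1; lra.
      by rewrite ler_norml; clear -nZ1 pZ1; lra.
    by move=> /ler_normlP[]; clear; lra.
  have h2 : g * (c / 2 + d) <= 3.
    rewrite (@le_trans _ _ (1 * (c / 2 + d)))// ?ler_wpM2r//;
      by clear -d0 d1 c0 cs s1; lra.
  by clear -h1 h2 c0 f2; lra.
have Z1b : - 1 <= Z1 <= 1 by apply/andP; split=> //; clear -nZ1; lra.
have g01 : 0 < g <= 1 by rewrite g0.
have i21 : i ^+ 2 <= 1 by rewrite (le_trans ii).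
(* If the coefficient of |b|^2 is not positive, the mixed term is large; if it is positive, a large
   real b suffices, even where the mixed term vanishes. *)
have [h|h] := leP 0 (Z1 + g / 2).
  apply: exists_hermitian_pos => //.
    by have := sqr_ge0 (1 - Z1); have := sqr_ge0 Z2; clear -gE E1; lra.
  by apply: (cross_term_big i0 cE _ i21 _ sE d2 gE) => //; rewrite E0.
have k0 : 0 < - (c * (Z1 + g / 2)) by rewrite oppr_gt0 pmulr_rlt0.
have [N HN] := exists_quadratic_pos (d * (Z1 + g) - c * (1 + g) + 2 * c * Z1) k0 A0.
by exists N, 0; rewrite expr0n /= addr0 mul0r subr0.
Qed.
End Direction.

Section NotSuperharmonic.
Variable R : realType.

Lemma disc_barrier_mean (E L s t0 Z1 Z2 : R) (c := s / L ^+ 2) (A := (1 + s) / L) :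
  0 < E <= 1 -> 1 <= L -> 0 < s -> 200 * (100 * s) <= E ^+ 2 -> 0 <= t0 <= L ->
  Z1 ^+ 2 + Z2 ^+ 2 < E ->
  exists b1 b2 : R, exists2 d : R, 0 < d &
    forall r, 0 < r <= d -> exists2 e : R, 0 < e &
    forall (v : R[i]^o -> \bar R) (z : R[i]^o) (m k : R), 0 < k ->
    (forall theta, (v ((z : R[i]) + r%:C * (cos theta +i* sin theta))%R
       <= (m - k * disc_barrier E A c t0 Z1 Z2 b1 b2 (r * cos theta) (r * sin theta))%:E)%E) ->
    (circle_mean v z r <= (m - k * (barrier E A c Z1 Z2 t0 1 0 + e))%:E)%E.
Proof.
move=> E01 L1 s0 sE t0L ZE.
have g0 : 0 < E - Z1 ^+ 2 - Z2 ^+ 2 by lra.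
have [b1 [b2 pos]] := levi_form_pos E01 L1 s0 sE t0L g0.
rewrite -/c -/A in pos; exists b1, b2.
have := jet_disc_barrier E A c t0 Z1 Z2 b1 b2; cbv zeta.
set k1 := fun w => _; set k2 := fun w => _ => HJ.
(* The coefficients of a quadratic form are recovered from its values at (1, 0), (0, 1) and (1,
   1). *)
pose p := k2 (1, 0); pose s' := k2 (0, 1).
apply: (@jet_circle_mean R _ _ (k1 (1, 0)) (k1 (0, 1)) p (k2 (1, 1) - p - s') s'); last first.
  apply: jet_ext HJ _ _ _ _ => // w; rewrite /k1 /p /s' /k2 /=; by field.
have -> : p + s' = 2 * ((b1 ^+ 2 + b2 ^+ 2) * - (c * (Z1 + (E - Z1 ^+ 2 - Z2 ^+ 2) / 2))
    + (b1 * ((A - 2 * c * t0) * (Z1 + (E - Z1 ^+ 2 - Z2 ^+ 2)) - c * (1 + (E - Z1 ^+ 2 - Z2 ^+ 2)) + 2 * c * Z1)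
       - b2 * ((A - 2 * c * t0) * Z2 - 2 * c * Z2))
    + (- (A * t0 - c * t0 ^+ 2) + ((A - 2 * c * t0) - c) * Z1
       - (E - Z1 ^+ 2 - Z2 ^+ 2) * (c / 2 + (A - 2 * c * t0)) + c)).
  by rewrite /p /s' /k2 /=; field.
by rewrite mulr_gt0.
Qed.
End NotSuperharmonic.

(** * The almost complex structure *)

Section Structure.
Variable R : realType.

Lemma forall_ord4 (P : 'I_4 -> Prop) : P 0 -> P 1 -> P 2 -> P 3 -> forall i, P i.
Proof.
move=> P0 P1 P2 P3 [[|[|[|[|i]]]] Hi] //.
- by have -> : Ordinal Hi = 0 by exact: val_inj.
- by have -> : Ordinal Hi = 1 by exact: val_inj.
- by have -> : Ordinal Hi = 2 by exact: val_inj.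
- by have -> : Ordinal Hi = 3 by exact: val_inj.
Qed.

Lemma big_ord4 (F : 'I_4 -> R) : \sum_j F j = F 0 + F 1 + F 2 + F 3.
Proof.
rewrite !big_ord_recl big_ord0 addr0 !addrA.
by congr (F _ + F _ + F _ + F _); exact: val_inj.
Qed.

Lemma col4P (u v : 'cV[R]_4) :
  u 0 0 = v 0 0 -> u 1 0 = v 1 0 -> u 2 0 = v 2 0 -> u 3 0 = v 3 0 -> u = v.
Proof.
move=> h0 h1 h2 h3; apply/matrixP => i j; rewrite (ord1 j).
by move: i; apply: forall_ord4.
Qed.

Lemma JmxE (p v : 'cV[R]_4) :
  [/\ (Jmx p *m v) 0 0 = - v 1 0,
      (Jmx p *m v) 1 0 = v 0 0,
      (Jmx p *m v) 2 0 = - (2 * p 3 0) * v 0 0 - 2 * p 2 0 * v 1 0 - v 3 0 &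
      (Jmx p *m v) 3 0 = - (2 * p 2 0) * v 0 0 + 2 * p 3 0 * v 1 0 + v 2 0].
Proof. by split; rewrite !mxE big_ord4 !mxE/=; ring. Qed.

Lemma Jmx_almost_complex : almost_complex_structure (@Jmx R).
Proof.
move=> p; apply/matrixP => i j.
have E (v : 'cV[R]_4) : Jmx p *m (Jmx p *m v) = - v.
  have [a0 a1 a2 a3] := JmxE p v.
  have [b0 b1 b2 b3] := JmxE p (Jmx p *m v).
  by apply: col4P; rewrite [RHS]mxE ?(b0, b1, b2, b3) ?(a0, a1, a2, a3); ring.
have := congr1 (fun M : 'cV[R]_4 => M i 0) (E (delta_mx j 0)).
by rewrite mulmxA -colE mxE => ->; rewrite !mxE eqxx andbT.

Qed.
End Structure.

(** * Maps of the complex plane *)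

Section ComplexPlane.
Variable R : realType.

Lemma normc_norm (z : R[i]) : `|z| = (normc z)%:C.
Proof. by []. Qed.

Lemma gt0_complexE (e : R[i]) : 0 < e -> e = (complex.Re e)%:C /\ 0 < complex.Re e.
Proof. by case: e => a b; rewrite ltcE/= => /andP[/eqP-> ->]. Qed.

(** The norm of [R[i]^o] takes its values in [R[i]]; here neighbourhoods are brought back to discs
    of real radius. *)
Lemma nbhs_disc (zeta : R[i]^o) (A : set R[i]^o) :
  nbhs zeta A <-> exists2 e : R, 0 < e & disc zeta e `<=` A.
Proof.
split=> [/nbhs_ballP[e /= e0 He]|[e e0 He]].
  have [eR ep] := gt0_complexE e0.
  exists (complex.Re e) => // w /= hw; apply: He.
  by rewrite -ball_normE/= distrC eR normc_norm ltcR.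
apply/nbhs_ballP; exists e%:C; first by rewrite /= ltcR.
by move=> w; rewrite -ball_normE/= distrC normc_norm ltcR; exact: He.
Qed.

Lemma ler_Re_normc (z : R[i]) : `|complex.Re z| <= normc z.
Proof. by rewrite -lecR; exact: normc_ge_Re. Qed.

Lemma ler_Im_normc (z : R[i]) : `|complex.Im z| <= normc z.
Proof.
case: z => a b /=; rewrite -[leLHS]sqrtr_sqr ler_wsqrtr// lerDr sqr_ge0.
by [].
Qed.

Lemma continuous_Re : continuous (fun z : R[i]^o => complex.Re (z : R[i]) : R).
Proof.
move=> z; apply/(@cvgrPdist_lt _ _ _ (nbhs z)) => e e0; apply/nbhs_disc; exists e => // w /= hw.
apply: le_lt_trans hw; rewrite distrC -[_ - _](raddfB (@complex.Re R)).
exact: ler_Re_normc.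
Qed.

Lemma continuous_Im : continuous (fun z : R[i]^o => complex.Im (z : R[i]) : R).
Proof.
move=> z; apply/(@cvgrPdist_lt _ _ _ (nbhs z)) => e e0; apply/nbhs_disc; exists e => // w /= hw.
apply: le_lt_trans hw; rewrite distrC -[_ - _](raddfB (@complex.Im R)).
exact: ler_Im_normc.
Qed.

Lemma cvg_mx (T : Type) (F : set_system T) (FF : Filter F) m n
    (f : T -> 'M[R]_(m, n)) (l : 'M[R]_(m, n)) :
  (forall i j, (fun x => f x i j) @ F --> l i j) -> f @ F --> l.
Proof.
move=> H; apply/cvgrPdist_le => e e0; near=> x.
rewrite [leLHS]/Num.Def.normr/= mx_normrE (bigmax_le _ (ltW e0))//= => i _.
rewrite !mxE; move: i; near: x; apply: filter_forall => /= i.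
by have /cvgrPdist_le := H i.1 i.2; exact.
Unshelve. all: by end_near. Qed.

Section Coordinates.
Variables (n : nat) (F Fx Fy : 'I_n -> R -> R -> R).
Hypothesis dFx : forall i (x y : R), is_derive x (1 : R) (F i ^~ y) (Fx i x y).
Hypothesis dFy : forall i (x y : R), is_derive y (1 : R) (F i x) (Fy i x y).
Let u (zeta : R[i]^o) : 'cV[R]_n := \col_i F i (complex.Re zeta) (complex.Im zeta).

Let dux i (zeta : R[i]^o) : is_derive (0 : R) 1
  (fun t => (u \o xline zeta) t i 0) (Fx i (complex.Re zeta) (complex.Im zeta)).
Proof.
have -> : (fun t => (u \o xline zeta) t i 0) =
   (F i ^~ (complex.Im zeta)) \o (fun t : R => complex.Re zeta + t).
  apply/funext => t; rewrite /= mxE /xline.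
  by case: zeta => a b; rewrite /= addr0.
have d0 : is_derive (0 : R) 1 (fun t : R => complex.Re zeta + t) 1.
  by apply: is_derive_eq; rewrite add0r mulr1.
have := dFx i (complex.Re zeta + 0) (complex.Im zeta).
by move=> /is_derive1_comp/(_ d0); rewrite mulr1 addr0.
Qed.

Let duy i (zeta : R[i]^o) : is_derive (0 : R) 1
  (fun t => (u \o yline zeta) t i 0) (Fy i (complex.Re zeta) (complex.Im zeta)).
Proof.
have -> : (fun t => (u \o yline zeta) t i 0) =
   (F i (complex.Re zeta)) \o (fun t : R => complex.Im zeta + t).
  apply/funext => t; rewrite /= mxE /yline.
  by case: zeta => a b; rewrite /= addr0.
have d0 : is_derive (0 : R) 1 (fun t : R => complex.Im zeta + t) 1.
  by apply: is_derive_eq; rewrite add0r mulr1.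
have := dFy i (complex.Re zeta) (complex.Im zeta + 0).
by move=> /is_derive1_comp/(_ d0); rewrite mulr1 addr0.
Qed.

Let derx zeta : derivable (u \o xline zeta) (0 : R) 1.
Proof. by apply/derivable_mxP => i j; rewrite (ord1 j); have [] := dux i zeta. Qed.

Let dery zeta : derivable (u \o yline zeta) (0 : R) 1.
Proof. by apply/derivable_mxP => i j; rewrite (ord1 j); have [] := duy i zeta. Qed.

Lemma dx_coords zeta :
  dx u zeta = \col_i Fx i (complex.Re zeta) (complex.Im zeta).
Proof.
rewrite /dx derive_mx//; apply/matrixP => i j; rewrite !mxE (ord1 j).
by have [_ ->] := dux i zeta.
Qed.

Lemma dy_coords zeta :
  dy u zeta = \col_i Fy i (complex.Re zeta) (complex.Im zeta).
Proof.
rewrite /dy derive_mx//; apply/matrixP => i j; rewrite !mxE (ord1 j).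
by have [_ ->] := duy i zeta.
Qed.

Lemma C1_coords D :
  (forall i, continuous (fun z : R[i]^o => Fx i (complex.Re z) (complex.Im z))) ->
  (forall i, continuous (fun z : R[i]^o => Fy i (complex.Re z) (complex.Im z))) ->
  C1_on D u.
Proof.
move=> cx cy zeta _; split=> //.
- rewrite /prop_for /continuous_at
    (_ : dx u = fun z => \col_i Fx i (complex.Re z) (complex.Im z)); last first.
    by apply/funext => z; exact: dx_coords.
  apply: (@cvg_mx _ (nbhs zeta)) => i j; rewrite mxE.
  by under eq_fun do rewrite mxE; exact: cx.
- rewrite /prop_for /continuous_at
    (_ : dy u = fun z => \col_i Fy i (complex.Re z) (complex.Im z)); last first.
    by apply/funext => z; exact: dy_coords.
  apply: (@cvg_mx _ (nbhs zeta)) => i j; rewrite mxE.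
  by under eq_fun do rewrite mxE; exact: cy.
Qed.

End Coordinates.
End ComplexPlane.

(** * The explicit J-holomorphic discs *)

Section Discs.
Variable R : realType.
Variables (p0 p1 w1 w2 q1 q2 b1 b2 : R).

Definition disc_coord (i : 'I_4) (x y : R) : R :=
  nth 0 [:: p0 + q1 * x - q2 * y; p1 + q2 * x + q1 * y;
            w1 * dbar_re b1 b2 x y - w2 * dbar_im b1 b2 x y;
            w2 * dbar_re b1 b2 x y + w1 * dbar_im b1 b2 x y] i.

Definition disc_map (zeta : R[i]^o) : 'cV[R]_4 :=
  \col_i disc_coord i (complex.Re zeta) (complex.Im zeta).

Let re_x x : R := (1 + b1) * expR (2 * x).
Let im_x x : R := b2 * expR (- 2 * x).
Let re_y y : R := - ((1 - b1 + b2) / 2 * expR (- 2 * y)) + (1 - b1 - b2) / 2 * expR (2 * y).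
Let im_y y : R := - ((1 - b1 + b2) / 2 * expR (- 2 * y)) - (1 - b1 - b2) / 2 * expR (2 * y).

(** V is a function of x plus a function of y, so its x-derivative involves x alone and its
    y-derivative y alone; continuity of the partial derivatives reduces to one real variable. *)
Let cx (i : 'I_4) (x y : R) : R :=
  nth 0 [:: q1; q2; w1 * re_x x - w2 * im_x x; w2 * re_x x + w1 * im_x x] i.
Let cy (i : 'I_4) (x y : R) : R :=
  nth 0 [:: - q2; q1; w1 * re_y y - w2 * im_y y; w2 * re_y y + w1 * im_y y] i.

Let dcx i (x y : R) : is_derive x (1 : R) (disc_coord i ^~ y) (cx i x y).
Proof.
move: i; apply: forall_ord4; rewrite /disc_coord /cx /= /dbar_re /dbar_im /re_x /im_x;
  by apply: is_derive_eq; rewrite /GRing.scale /=; field.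
Qed.

Let dcy i (x y : R) : is_derive y (1 : R) (disc_coord i x) (cy i x y).
Proof.
move: i; apply: forall_ord4; rewrite /disc_coord /cy /= /dbar_re /dbar_im /re_y /im_y;
  by apply: is_derive_eq; rewrite /GRing.scale /=; field.
Qed.

Let cont_x (g : R -> R) : (forall x, derivable g x 1) ->
  continuous (fun z : R[i]^o => g (complex.Re (z : R[i]))).
Proof.
move=> dg z; apply: (@continuous_comp _ _ _ (fun z : R[i]^o => complex.Re (z : R[i]) : R) g).
  exact: continuous_Re.
by apply: differentiable_continuous; apply/derivable1_diffP.
Qed.

Let cont_y (g : R -> R) : (forall x, derivable g x 1) ->
  continuous (fun z : R[i]^o => g (complex.Im (z : R[i]))).
Proof.
move=> dg z; apply: (@continuous_comp _ _ _ (fun z : R[i]^o => complex.Im (z : R[i]) : R) g).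
  exact: continuous_Im.
by apply: differentiable_continuous; apply/derivable1_diffP.
Qed.

(** The hypotheses say w q = conj w for w = w1 + i w2, q = q1 + i q2. With u1' = q and u2 = w V,
    both sides of d u2 / d conj zeta = conj u2 conj u1' are then w conj V. *)
Lemma disc_map_J_holomorphic D :
  w1 = w1 * q1 - w2 * q2 -> w2 = - w1 * q2 - w2 * q1 ->
  J_holomorphic_on (@Jmx R) D disc_map.
Proof.
move=> e1 e2; split.
  apply: (C1_coords dcx dcy) => i.
    by apply: (cont_x (g := fun x => cx i x 0)) => x; move: i;
      apply: forall_ord4; rewrite /cx /= /re_x /im_x; exact: ex_derive.
  by apply: (cont_y (g := fun y => cy i 0 y)) => y; move: i;
      apply: forall_ord4; rewrite /cy /= /re_y /im_y; exact: ex_derive.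
move=> zeta _.
set x := complex.Re (zeta : R[i]); set y := complex.Im (zeta : R[i]).
pose v : 'cV[R]_4 := \col_i cx i x y.
have -> : dx disc_map zeta = v by exact: (dx_coords dcx).
have -> : dy disc_map zeta = \col_i cy i x y by exact: (dy_coords dcy).
have [j0 j1 j2 j3] := JmxE (disc_map zeta) v.
(* Real and imaginary parts of 2 dV / d conj zeta = 2 conj V. *)
have Ea : re_x x - im_y y = 2 * dbar_re b1 b2 x y by rewrite /re_x /im_y /dbar_re; field.
have Eb : re_y y + im_x x = - 2 * dbar_im b1 b2 x y by rewrite /im_x /re_y /dbar_im; field.
apply: col4P; rewrite ?(j0, j1, j2, j3) !mxE /cy /cx /disc_coord /=.
- by [].
- by [].
- rewrite -/x -/y.
  have : w1 * (re_y y + im_x x) + w2 * (re_x x - im_y y)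
     = - 2 * (dbar_re b1 b2 x y * - (- w1 * q2 - w2 * q1) + dbar_im b1 b2 x y * (w1 * q1 - w2 * q2)).
    rewrite Ea Eb -e1 -e2; ring.
  move=> h; apply/eqP; rewrite -subr_eq0; apply/eqP; move/eqP: h; rewrite -subr_eq0 => /eqP <-; ring.
- rewrite -/x -/y.
  have : w2 * (re_y y + im_x x) - w1 * (re_x x - im_y y)
     = - 2 * (dbar_re b1 b2 x y * (w1 * q1 - w2 * q2) + dbar_im b1 b2 x y * (- w1 * q2 - w2 * q1)).
    rewrite Ea Eb -e1 -e2; ring.
  move=> h; apply/eqP; rewrite -subr_eq0; apply/eqP; move/eqP: h; rewrite -subr_eq0 => /eqP <-; ring.
Qed.
End Discs.

(** * Semicontinuous functions on compact sets *)

Section Semicontinuity.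
Variable R : realType.

Lemma ereal_real_between (x y : \bar R) : (x < y)%E ->
  exists c : R, (x < c%:E /\ c%:E < y)%E.
Proof.
case: x y => [x| |] [y| |] //=; rewrite ?lte_fin => xy.
- by exists ((x + y) / 2); rewrite !lte_fin; split; lra.
- by exists (x + 1); rewrite lte_fin ltry; split=> //; lra.
- by exists (y - 1); rewrite lte_fin ltNyr; split=> //; lra.
- by exists 0; rewrite ltNyr ltry.
Qed.

(** If the supremum S is not attained, every point has a neighbourhood where f stays below some b <
    S; by compactness one b works on all of K, contradicting the choice of S. The filter [F]
    expresses b tending to S from below. *)
Lemma usc_compact_max (T : topologicalType) (K : set T) (f : T -> \bar R) :
  compact K -> K !=set0 -> upper_semicontinuous_on K f ->
  exists2 p, K p & forall q, K q -> (f q <= f p)%E.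
Proof.
move=> cK [k0 Kk0] uscf; apply: contrapT => nomax.
pose S := ereal_sup (f @` K).
have ltS p : K p -> (f p < S)%E.
  move=> Kp; rewrite lt_neqAle; apply/andP; split; last first.
    by apply: ereal_sup_ubound; exists p.
  apply/eqP => fS; apply: nomax; exists p => // q Kq; rewrite fS.
  by apply: ereal_sup_ubound; exists q.
pose F : set_system (\bar R) := [set A | exists2 a, (a < S)%E &
  forall b, (a <= b)%E -> (b < S)%E -> A b].
have FF : Filter F.
  split.
  - by exists (f k0) => //; exact: ltS.
  - move=> A B [a aS HA] [b bS HB]; exists (maxe a b); first by rewrite gt_max aS bS.
    by move=> c; rewrite ge_max => /andP[ac bc] cS; split; [exact: HA|exact: HB].
  - by move=> A B AB [a aS HA]; exists a => // b ab bS; apply: AB; exact: HA.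
have /compact_near_coveringP/(_ _ F (fun b x => (f x < b)%E) FF) := cK.
case.
  move=> x Kx; have [c [fxc cS]] := ereal_real_between (ltS _ Kx).
  exists ([set y | (f y < c%:E)%E], [set b | (c%:E <= b)%E]).
    split; first exact: uscf.
    by exists c%:E.
  by move=> [y b] /= [h1 h2]; exact: lt_le_trans h1 h2.
move=> a aS Ha; have : (S <= a)%E.
  by apply: ge_ereal_sup => _ [x Kx <-]; apply: ltW; exact: (Ha a).
by rewrite leNgt aS.
Qed.

Lemma usc_addr (T : topologicalType) (K : set T) (f : T -> \bar R) (h : T -> R) :
  (forall p, K p -> (f p < +oo)%E) ->
  upper_semicontinuous_on K f -> (forall p, K p -> {for p, continuous h}) ->
  upper_semicontinuous_on K (fun p => (f p + (h p)%:E)%E).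
Proof.
move=> foo uf ch p Kp a fha.
have : (f p < (a - h p)%:E)%E.
  by move: fha; rewrite -lteBrDr.
move=> /ereal_real_between[b [fb]]; rewrite lte_fin => ba.
have hb : \forall q \near p, h q < a - b.
  by apply: (cvgr_lt (h p)); [exact: ch|lra].
near=> q.
have h1 : (f q < b%:E)%E by near: q; exact: uf.
have h2 : h q < a - b by near: q.
have -> : a = b + (a - b) by ring.
by rewrite EFinD lteD// lte_fin.
Unshelve. all: by end_near. Qed.

End Semicontinuity.

(** * Barriers and discs in the domain *)

Section Shell.
Variable R : realType.
Implicit Types p : 'cV[R]_4.

Definition sqn1 p : R := p 0 0 ^+ 2 + p 1 0 ^+ 2.
Definition sqn2 p : R := p 2 0 ^+ 2 + p 3 0 ^+ 2.
(** This is log (rho / |z2|). At z2 = 0 its value is conventional, hence the separate condition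
    [0 < sqn2 p] in [shell]. *)
Definition height (rho : R) p : R := ln rho - ln (sqn2 p) / 2.
Definition cos2arg p : R := (p 2 0 ^+ 2 - p 3 0 ^+ 2) / sqn2 p.
Definition sin2arg p : R := 2 * p 2 0 * p 3 0 / sqn2 p.

Definition point_barrier (E A c rho : R) p : R :=
  barrier E A c (p 0 0) (p 1 0) (height rho p) (cos2arg p) (sin2arg p).

Definition shell (E rho L : R) : set 'cV[R]_4 :=
  [set p | [/\ sqn1 p <= E, 0 < sqn2 p & 0 <= height rho p <= L]].

Lemma cos2arg2Dsin2arg2 p : 0 < sqn2 p -> cos2arg p ^+ 2 + sin2arg p ^+ 2 = 1.
Proof.
by move=> n0; rewrite /cos2arg /sin2arg /sqn2; field; rewrite gt_eqF.
Qed.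

(* zeta |-> (z1 + (conj z2 / z2) zeta, z2 V(zeta)); the factor conj z2 / z2 makes
   it J-holomorphic. *)
Definition disc_at p (b1 b2 : R) : R[i]^o -> 'cV[R]_4 :=
  disc_map (p 0 0) (p 1 0) (p 2 0) (p 3 0) (cos2arg p) (- sin2arg p) b1 b2.

Lemma disc_at_J_holomorphic p b1 b2 D : 0 < sqn2 p ->
  J_holomorphic_on (@Jmx R) D (disc_at p b1 b2).
Proof.
move=> n0; apply: disc_map_J_holomorphic;
  by rewrite /cos2arg /sin2arg /sqn2; field; rewrite gt_eqF.
Qed.

Section AlongDisc.
Variables (p : 'cV[R]_4) (b1 b2 : R) (p2 : 0 < sqn2 p).
Let Z1 := p 0 0 * cos2arg p - p 1 0 * sin2arg p.
Let Z2 := p 0 0 * sin2arg p + p 1 0 * cos2arg p.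
Let u x y := disc_at p b1 b2 (x +i* y).
Let n x y := dbar_re b1 b2 x y ^+ 2 + dbar_im b1 b2 x y ^+ 2.

Lemma disc_atE x y :
  [/\ u x y 0 0 = p 0 0 + cos2arg p * x + sin2arg p * y,
      u x y 1 0 = p 1 0 - sin2arg p * x + cos2arg p * y,
      u x y 2 0 = p 2 0 * dbar_re b1 b2 x y - p 3 0 * dbar_im b1 b2 x y &
      u x y 3 0 = p 3 0 * dbar_re b1 b2 x y + p 2 0 * dbar_im b1 b2 x y].
Proof. by split; rewrite /u /disc_at /disc_map mxE /disc_coord /=; ring. Qed.

Lemma disc_at0 : u 0 0 = p.
Proof.
have [h0 h1 h2 h3] := disc_atE 0 0.
have a0 : dbar_re b1 b2 0 0 = 1 :> R by rewrite /dbar_re !mulr0 expR0; field.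
have e0 : dbar_im b1 b2 0 0 = 0 :> R by rewrite /dbar_im !mulr0 expR0; field.
by apply: col4P; rewrite ?(h0, h1, h2, h3) ?a0 ?e0; ring.
Qed.

Lemma sqn1_disc x y : sqn1 (u x y) = (Z1 + x) ^+ 2 + (Z2 + y) ^+ 2.
Proof.
have [h0 h1 _ _] := disc_atE x y; rewrite /sqn1 h0 h1 /Z1 /Z2.
have := cos2arg2Dsin2arg2 p2; move: (cos2arg p) (sin2arg p) => C S CS.
have -> : (p 0 0 + C * x + S * y) ^+ 2 + (p 1 0 - S * x + C * y) ^+ 2
  = (p 0 0) ^+ 2 + p 1 0 ^+ 2 + 2 * (p 0 0 * (C * x + S * y) + p 1 0 * (C * y - S * x))
    + (C ^+ 2 + S ^+ 2) * (x ^+ 2 + y ^+ 2) by ring.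
have -> : (p 0 0 * C - p 1 0 * S + x) ^+ 2 + (p 0 0 * S + p 1 0 * C + y) ^+ 2
  = (C ^+ 2 + S ^+ 2) * ((p 0 0) ^+ 2 + p 1 0 ^+ 2) + 2 * (p 0 0 * (C * x + S * y) + p 1 0 * (C * y - S * x))
    + (x ^+ 2 + y ^+ 2) by ring.
by rewrite CS !mul1r.
Qed.

Lemma sqn2_disc x y : sqn2 (u x y) = sqn2 p * n x y.
Proof. by have [_ _ h2 h3] := disc_atE x y; rewrite /sqn2 h2 h3 /n; ring. Qed.

Lemma height_disc rho x y : 0 < n x y ->
  height rho (u x y) = height rho p - ln (n x y) / 2.
Proof. by move=> n0; rewrite /height sqn2_disc lnM ?posrE//; field. Qed.

(** The argument of z2 disappears: |u1| = |Z + zeta|, log |u2| = log |z2| + log |V| and u1 u2 / conj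
    u2 = (Z + zeta) V / conj V. One expansion thus serves all centres. *)
Lemma point_barrier_disc E A c rho x y : 0 < n x y ->
  point_barrier E A c rho (u x y) =
  disc_barrier E A c (height rho p) Z1 Z2 b1 b2 x y.
Proof.
move=> n0; rewrite /point_barrier /disc_barrier height_disc// -/(n x y).
rewrite /barrier; congr (_ * _ + c * _ - c).
  have -> : E - u x y 0 0 ^+ 2 - u x y 1 0 ^+ 2 = E - sqn1 (u x y) by rewrite /sqn1; ring.
  by rewrite sqn1_disc; ring.
rewrite {1}/cos2arg {1}/sin2arg sqn2_disc.
have [-> -> -> ->] := disc_atE x y; rewrite /Z1 /Z2.
have CE : p 2 0 ^+ 2 - p 3 0 ^+ 2 = sqn2 p * cos2arg p.
  by rewrite /cos2arg; field; rewrite gt_eqF.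
have SE : 2 * p 2 0 * p 3 0 = sqn2 p * sin2arg p.
  by rewrite /sin2arg; field; rewrite gt_eqF.
have := cos2arg2Dsin2arg2 p2; move: (cos2arg p) (sin2arg p) CE SE => C S CE SE CS.
set a := dbar_re _ _ _ _; set b := dbar_im _ _ _ _.
have -> : (p 2 0 * a - p 3 0 * b) ^+ 2 - (p 3 0 * a + p 2 0 * b) ^+ 2
  = (p 2 0 ^+ 2 - p 3 0 ^+ 2) * (a ^+ 2 - b ^+ 2) - (2 * p 2 0 * p 3 0) * (2 * a * b) by ring.
have -> : 2 * (p 2 0 * a - p 3 0 * b) * (p 3 0 * a + p 2 0 * b)
  = (2 * p 2 0 * p 3 0) * (a ^+ 2 - b ^+ 2) + (p 2 0 ^+ 2 - p 3 0 ^+ 2) * (2 * a * b) by ring.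
rewrite CE SE.
have n1 : n x y != 0 by rewrite gt_eqF.
have s1 : sqn2 p != 0 by rewrite gt_eqF.
(* The rotated increment comes out as (C^2 + S^2) x; inserting this factor 1 leaves a rational
   identity. *)
have -> : p 0 0 * C - p 1 0 * S + x = p 0 0 * C - p 1 0 * S + (C ^+ 2 + S ^+ 2) * x.
  by rewrite CS mul1r.
have -> : p 0 0 * S + p 1 0 * C + y = p 0 0 * S + p 1 0 * C + (C ^+ 2 + S ^+ 2) * y.
  by rewrite CS mul1r.
move: n1; rewrite {1}/n -/a -/b => n1.
rewrite /n -/a -/b; field; first by rewrite s1 n1.
Qed.

End AlongDisc.
End Shell.

(** * Continuity of the barrier and compactness of the shell *)

Section MaximumPrinciple.
Variable R : realType.
Implicit Types p : 'cV[R]_4.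

Lemma continuous_sqn1 p : {for p, continuous (@sqn1 R)}.
Proof.
by apply: continuousD; apply: continuousM; exact: coord_continuous.
Qed.

Lemma continuous_sqn2 p : {for p, continuous (@sqn2 R)}.
Proof.
by apply: continuousD; apply: continuousM; exact: coord_continuous.
Qed.

Lemma continuous_height rho p : 0 < sqn2 p -> {for p, continuous (height rho)}.
Proof.
move=> p2; apply: continuousB; first exact: cst_continuous.
apply: continuousM; last exact: cst_continuous.
apply: (@continuous_comp _ _ _ (@sqn2 R) (@ln R)); first exact: continuous_sqn2.
exact: continuous_ln.
Qed.

Lemma continuous_point_barrier E A c rho p : 0 < sqn2 p ->
  {for p, continuous (point_barrier E A c rho)}.
Proof.
move=> p2.
have ct := continuous_height (rho := rho) p2.
have cV : {for p, continuous (fun q => (sqn2 q)^-1)}.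
  by apply: continuousV; [rewrite gt_eqF|exact: continuous_sqn2].
have cc i : {for p, continuous (fun q : 'cV[R]_4 => q i 0)} by exact: coord_continuous.
have ck (a : R) : {for p, continuous (fun _ : 'cV[R]_4 => a)} by exact: cst_continuous.
have csq i := continuousM (cc i) (cc i).
have cC : {for p, continuous (@cos2arg R)} by exact: continuousM (continuousB (csq 2) (csq 3)) cV.
have cS : {for p, continuous (@sin2arg R)}.
  exact: continuousM (continuousM (continuousM (ck 2) (cc 2)) (cc 3)) cV.
have c1 := continuousB (continuousB (ck E) (csq 0)) (csq 1).
have c2 := continuousB (continuousM (ck A) ct) (continuousM (ck c) (continuousM ct ct)).
have c3 := continuousM (ck c) (continuousB (continuousM (cc 0) cC) (continuousM (cc 1) cS)).
exact: continuousB (continuousD (continuousM c1 c2) c3) (ck c).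
Qed.

(** In terms of |z2|^2 the bounds on the height read m <= |z2|^2 <= rho^2 with m > 0: closed
    conditions that imply the strict one. The transpose passes to row vectors, where the cube
    [-1, 1]^4 is compact by [rV_compact]. *)
Lemma shell_compact E rho L : E <= 1 -> 0 < rho <= 1 ->
  compact [set v : 'rV[R]_4 | shell E rho L v^T].
Proof.
move=> E1 /andP[r0 r1].
pose m := (rho * expR (- L)) ^+ 2.
have m0 : 0 < m by rewrite exprn_gt0// mulr_gt0// expR_gt0.
have lnm : ln m / 2 = ln rho - L.
  by rewrite /m lnXn ?mulr_gt0 ?expR_gt0// lnM ?posrE ?expR_gt0// expRK -mulr_natl; field.
have rr : 0 < rho ^+ 2 by rewrite exprn_gt0.
have lnr : ln (rho ^+ 2) = 2 * ln rho by rewrite lnXn// mulr_natl.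
have -> : [set v : 'rV[R]_4 | shell E rho L v^T] =
    [set v : 'rV[R]_4 | sqn1 v^T <= E] `&` [set v | m <= sqn2 v^T]
      `&` [set v | sqn2 v^T <= rho ^+ 2].
  apply/seteqP; split=> v /=.
    move=> [h1 h2 /andP[h3 h4]]; rewrite /height in h3 h4; split; first split=> //.
      by rewrite /= -ler_ln ?posrE//; lra.
    have : ln (sqn2 v^T) <= ln (rho ^+ 2) by rewrite lnr; lra.
    by rewrite ler_ln ?posrE.
  move=> [[h1 h2] h3]; have p2 : 0 < sqn2 v^T by exact: lt_le_trans h2.
  have h2' : ln m <= ln (sqn2 v^T) by rewrite ler_ln ?posrE.
  have h3' : ln (sqn2 v^T) <= ln (rho ^+ 2) by rewrite ler_ln ?posrE.
  rewrite lnr in h3'.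
  by split=> //; rewrite /height; lra.
have cT : continuous (fun v : 'rV[R]_4 => v^T).
  move=> v; apply: (@cvg_mx _ _ (nbhs v)) => i j; rewrite mxE.
  by under eq_fun do rewrite mxE; exact: coord_continuous.
have c1 : continuous (fun v : 'rV[R]_4 => sqn1 v^T).
  by move=> v; apply: continuous_comp; [exact: cT|exact: continuous_sqn1].
have c2 : continuous (fun v : 'rV[R]_4 => sqn2 v^T).
  by move=> v; apply: continuous_comp; [exact: cT|exact: continuous_sqn2].
have box := @rV_compact R 4 (fun=> `[(-1 : R), 1]%classic) (fun=> @segment_compact R (-1) 1).
apply: subclosed_compact box _.
  apply: closedI; first apply: closedI.
  - by apply: (@closed_comp _ _ (fun v : 'rV[R]_4 => sqn1 v^T) [set x | x <= E]) => [v _|];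
      [exact: c1|exact: closed_le].
  - by apply: (@closed_comp _ _ (fun v : 'rV[R]_4 => sqn2 v^T) [set x | m <= x]) => [v _|];
      [exact: c2|exact: closed_ge].
  - by apply: (@closed_comp _ _ (fun v : 'rV[R]_4 => sqn2 v^T) [set x | x <= rho ^+ 2]) => [v _|];
      [exact: c2|exact: closed_le].
move=> v [[h1 _] h3] i.
have sq1 (x y : R) : x ^+ 2 + y ^+ 2 <= 1 -> x \in `[-1, 1] /\ y \in `[-1, 1].
  move=> xy; have [hx hy] := (sqr_ge0 x, sqr_ge0 y).
  by split; rewrite in_itv /= -ler_norml -(@expr_le1 _ 2)// real_normK ?num_real//; lra.
have [a0 a1] : v 0 0 \in `[-1, 1] /\ v 0 1 \in `[-1, 1].
  by apply: sq1; move: h1; rewrite /= /sqn1 !mxE; lra.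
have [a2 a3] : v 0 2 \in `[-1, 1] /\ v 0 3 \in `[-1, 1].
  apply: sq1; move: h3; rewrite /= /sqn2 !mxE => /le_trans; apply.
  by rewrite expr_le1 // ltW.
by move: i; apply: forall_ord4.
Qed.

End MaximumPrinciple.

(** * The maximum principle for the barrier *)

Section MaximumPrinciple.
Variable R : realType.
Implicit Types p : 'cV[R]_4.

Lemma disc_in_shell E rho L p b1 b2 : 0 < sqn2 p -> sqn1 p < E -> 0 < height rho p < L ->
  exists2 d : R, 0 < d & forall x y, `|x| <= d -> `|y| <= d ->
   0 < dbar_re b1 b2 x y ^+ 2 + dbar_im b1 b2 x y ^+ 2 /\ shell E rho L (disc_at p b1 b2 (x +i* y)).
Proof.
move=> p2 p1 /andP[h0 hL].
set Z1 := p 0 0 * cos2arg p - p 1 0 * sin2arg p.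
set Z2 := p 0 0 * sin2arg p + p 1 0 * cos2arg p.
have ZE : Z1 ^+ 2 + Z2 ^+ 2 < E.
  have := sqn1_disc b1 b2 p2 0 0; rewrite !addr0 -/Z1 -/Z2 => <-.
  by rewrite disc_at0.
have Jx := jetD (jet_cst (@unit_square R) Z1) (jet_lin (@bounded0_fst R)).
have Jy := jetD (jet_cst (@unit_square R) Z2) (jet_lin (@bounded0_snd R)).
have Jg := jetD (jet_cst (@unit_square R) E) (jet_scale (- 1) (jetD (jetM Jx Jx) (jetM Jy Jy))).
have Jn := jet_sqn_dbar b1 b2.
have Jt := jet_height b1 b2 (height rho p).
have JL := jetD (jet_cst (@unit_square R) L) (jet_scale (- 1) Jt).
have e1 := jet_gt Jg (m := 0) _; have e2 := jet_gt Jn ltr01.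
have e3 := jet_gt Jt h0; have e4 := jet_gt JL (m := 0) _.
have [||d d0 Hd] := near0_and (near0_and (e1 _) e2) (near0_and e3 (e4 _)).
- by rewrite /=; lra.
- by rewrite /=; lra.
exists d => // x y xd yd.
(* Every point of the square of half-side d is d times a direction, so the expansions are used at
   the single radius r = d. *)
have dx : x = d * (x / d) by field; rewrite gt_eqF.
have dy : y = d * (y / d) by field; rewrite gt_eqF.
have Pw : unit_square (x / d, y / d).
  by split; rewrite /= normrM normfV (gtr0_norm d0) ler_pdivrMr// mul1r.
have [[h1 n0] [h3 h4]] := Hd d _ (introT andP (conj (ltW d0) (lexx d))) Pw.
rewrite /= -dx -dy in h1 n0 h3 h4; split=> //; split.
- by rewrite (sqn1_disc b1 b2 p2) -/Z1 -/Z2; lra.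
- by rewrite sqn2_disc mulr_gt0.
- by rewrite height_disc//; apply/andP; split; lra.
Qed.

(** As |z1| <= 1, the term Re (z1 z2 / conj z2) is at most 1 and the final - c makes the correction
    nonpositive. In particular the barrier is nonpositive on |z1|^2 = E and on t = 0. *)
Lemma point_barrier_le (E A c rho : R) p : 0 <= c -> E <= 1 -> sqn1 p <= E -> 0 < sqn2 p ->
  point_barrier E A c rho p <=
    (E - sqn1 p) * (A * height rho p - c * height rho p ^+ 2).
Proof.
move=> c0 E1 pE p2; rewrite /point_barrier /barrier.
have := cos2arg2Dsin2arg2 p2; move: (cos2arg p) (sin2arg p) (height rho p) => C S t CS.
have h : p 0 0 * C - p 1 0 * S <= 1.
  have := sqr_ge0 (p 0 0 - C); have := sqr_ge0 (p 1 0 + S); rewrite /sqn1 in pE; lra.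
have := ler_wpM2l c0 h; rewrite /sqn1; lra.
Qed.

Lemma point_barrier_ge (E A c rho : R) p : 0 <= c -> E <= 1 -> sqn1 p <= E -> 0 < sqn2 p ->
    (E - sqn1 p) * (A * height rho p - c * height rho p ^+ 2) - 2 * c <=
  point_barrier E A c rho p.
Proof.
move=> c0 E1 pE p2; rewrite /point_barrier /barrier.
have := cos2arg2Dsin2arg2 p2; move: (cos2arg p) (sin2arg p) (height rho p) => C S t CS.
have h : - 1 <= p 0 0 * C - p 1 0 * S.
  have := sqr_ge0 (p 0 0 + C); have := sqr_ge0 (p 1 0 - S); rewrite /sqn1 in pE; lra.
have := ler_wpM2l c0 h; rewrite /sqn1; lra.
Qed.

(** At a positive maximum of lambda + k H the barrier H is positive, since lambda <= 0; the upper
    bound on H then excludes the boundary, and the disc of [disc_barrier_mean] through the maximum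
    violates the sub-mean value property. *)
Lemma barrier_maximum_principle (Omega : set 'cV[R]_4) (lambda : 'cV[R]_4 -> \bar R)
    (E L s rho k : R) (c := s / L ^+ 2) (A := (1 + s) / L) :
  J_plurisubharmonic_on (@Jmx R) Omega lambda ->
  0 < E <= 1 -> 1 <= L -> 0 < s -> 200 * (100 * s) <= E ^+ 2 -> 0 < rho <= 1 -> 0 < k ->
  shell E rho L `<=` Omega ->
  (forall p, shell E rho L p -> (lambda p <= 0)%E) ->
  (forall p, shell E rho L p -> height rho p = L ->
     (lambda p <= (- (k * (E - sqn1 p)))%:E)%E) ->
  forall p, shell E rho L p -> (lambda p <= (- (k * point_barrier E A c rho p))%:E)%E.
Proof.
move=> [[lam_lt lam_usc] _ _ lam_sh] E01 L1 s0 sE rho01 k0 sO bd0 bdL.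
have [E0 E1] := andP E01.
have L0 : 0 < L by lra.
have c0 : 0 < c by rewrite divr_gt0 ?exprn_gt0.
set H := point_barrier E A c rho.
pose Phi p := (lambda p + (k * H p)%:E)%E.
pose K : set 'rV[R]_4 := [set v | shell E rho L v^T].
have cK : compact K by apply: shell_compact.
apply: contrapT => /existsNP[p0 /not_implyP[Sp0 /negP]]; rewrite -ltNge => Hp0.
have uPhi : upper_semicontinuous_on (shell E rho L) Phi.
  apply: usc_addr.
  - by move=> p /sO; exact: lam_lt.
  - by move=> p /sO; exact: lam_usc.
  - move=> p [_ p2 _]; apply: continuousM; first exact: cst_continuous.
    exact: continuous_point_barrier.
have cT : continuous (fun v : 'rV[R]_4 => v^T).
  move=> v; apply: (@cvg_mx _ _ (nbhs v)) => i j; rewrite mxE.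
  by under eq_fun do rewrite mxE; exact: coord_continuous.
have uK : upper_semicontinuous_on K (fun v => Phi v^T).
  move=> v Kv a Pa; exact: (cT v _ (uPhi _ Kv a Pa)).
have K0 : K !=set0 by exists p0^T; rewrite /K /= trmxK.
have [v Kv vmax] := usc_compact_max cK K0 uK.
set p := v^T in vmax Kv *.
have pmax q : shell E rho L q -> (Phi q <= Phi p)%E.
  by move=> Sq; have := vmax q^T; rewrite /K /= trmxK; exact.
have Phi_pos : (0 < Phi p)%E.
  apply: lt_le_trans (pmax _ Sp0); rewrite /Phi.
  move: Hp0 (lam_lt p0 (sO _ Sp0)); case: (lambda p0) => [l| |] //=.
  by rewrite !lte_fin => h _; lra.
have [l lE] : exists l : R, lambda p = l%:E.
  have := lam_lt p (sO _ Kv); move: Phi_pos; rewrite /Phi.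
  by case: (lambda p) => [l| |] //= _ _; exists l.
pose m := l + k * H p.
have m0 : 0 < m by move: Phi_pos; rewrite /Phi lE -EFinD lte_fin.
have qbound q : shell E rho L q -> (lambda q <= (m - k * H q)%:E)%E.
  move=> /pmax; rewrite /Phi lE -EFinD -/m.
  case: (lambda q) => [lq| |] /=; [|by []|by rewrite !leNye].
  by rewrite !lee_fin; lra.
have [p1 p2 /andP[h0 hL]] := Kv.
(* Normalisation of the profile: A and c are chosen so that it is 1 at t = L and 1/2 + s/4 at t =
   L/2. *)
have HLE : A * L - c * L ^+ 2 = 1.
  by rewrite /A /c; field; rewrite gt_eqF.
have Hle : H p <= (E - sqn1 p) * (A * height rho p - c * height rho p ^+ 2).
  by apply: point_barrier_le => //; exact: ltW.
have lle0 : l <= 0 by have := bd0 _ Kv; rewrite lE lee_fin.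
have Hpos : 0 < H p.
  by rewrite -(pmulr_rgt0 _ k0); move: m0; rewrite /m; lra.
have p1s : sqn1 p < E.
  rewrite lt_neqAle p1 andbT; apply/eqP => pE.
  by move: Hle; rewrite pE subrr mul0r leNgt Hpos.
have h0s : 0 < height rho p.
  rewrite lt_neqAle h0 andbT; apply/eqP => pE.
  by move: Hle; rewrite -pE expr0n /= !mulr0 subrr mulr0 leNgt Hpos.
have hLs : height rho p < L.
  rewrite lt_neqAle hL andbT; apply/eqP => pE.
  have := bdL _ Kv pE; rewrite lE lee_fin.
  move: Hle; rewrite pE HLE mulr1 => /(ler_wpM2l (ltW k0)).
  by move: m0; rewrite /m; lra.
set Z1 := p 0 0 * cos2arg p - p 1 0 * sin2arg p.
set Z2 := p 0 0 * sin2arg p + p 1 0 * cos2arg p.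
have ZE : Z1 ^+ 2 + Z2 ^+ 2 < E.
  have := sqn1_disc 0 0 p2 0 0; rewrite !addr0 -/Z1 -/Z2 => <-.
  by rewrite disc_at0.
have hh : 0 <= height rho p <= L by rewrite h0.
have [b1 [b2 [d d0 Hd]]] := disc_barrier_mean E01 L1 s0 sE hh ZE.
have [d' d'0 Hd'] := disc_in_shell b1 b2 p2 p1s (introT andP (conj h0s hLs)).
pose u := disc_at p b1 b2.
have uS zeta : disc 0 d' zeta -> 0 < dbar_re b1 b2 (complex.Re zeta) (complex.Im zeta) ^+ 2
     + dbar_im b1 b2 (complex.Re zeta) (complex.Im zeta) ^+ 2 /\ shell E rho L (u zeta).
  rewrite /disc /= subr0 => hz.
  have := Hd' (complex.Re zeta) (complex.Im zeta).
  by case: zeta hz => x y hz; apply; apply/ltW; apply: le_lt_trans hz;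
    [exact: (ler_Re_normc (x +i* y))|exact: (ler_Im_normc (x +i* y))].
have [_ _ sub] := lam_sh 0 d' u d'0 (disc_at_J_holomorphic b1 b2 _ p2)
  (fun z hz => sO _ (uS z hz).2).
pose r := Num.min d (d' / 2).
have r0 : 0 < r by rewrite lt_min d0 divr_gt0.
have rd : 0 < r <= d by rewrite r0 ge_min lexx.
have rd' : r < d'.
  by apply: (@le_lt_trans _ _ (d' / 2)); [rewrite ge_min lexx orbT|lra].
have cd : closed_disc 0 r `<=` disc 0 d'.
  by move=> z; rewrite /closed_disc /disc /= => h; exact: le_lt_trans h rd'.
have := sub 0 r r0 cd.
have [e e0 He] := Hd r rd.
have up := He (lambda \o u) 0 m k k0.
move/le_trans; move/(_ _ (up _)).
have u0 : u 0 = p by exact: disc_at0.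
have HE : H p = barrier E A c Z1 Z2 (height rho p) 1 0.
  have n1 : dbar_re b1 b2 0 0 ^+ 2 + dbar_im b1 b2 0 0 ^+ 2 = 1.
    by rewrite /dbar_re /dbar_im !mulr0 expR0; field.
  have := @point_barrier_disc R p b1 b2 p2 E A c rho 0 0; rewrite disc_at0 n1 => /(_ ltr01) HE; rewrite /H HE.
  rewrite /disc_barrier -/Z1 -/Z2 n1 ln1 mul0r subr0 !addr0.
  have -> : dbar_re b1 b2 0 0 = 1 by rewrite /dbar_re !mulr0 expR0; field.
  have -> : dbar_im b1 b2 0 0 = 0 by rewrite /dbar_im !mulr0 expR0; field.
  by rewrite expr1n expr0n /= subr0 divr1 mulr0 mul0r.
rewrite -HE /= u0 lE lee_fin => contra.
suff : false by [].
have ke : 0 < k * e by rewrite mulr_gt0.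
suff : l <= m - k * (H p + e) by rewrite /m; lra.
apply: contra => theta.
have -> : ((0 : R[i]) + r%:C * (cos theta +i* sin theta))%R
  = ((r * cos theta) +i* (r * sin theta)) :> R[i].
  by rewrite add0r; apply/eqP; rewrite eq_complex /= !mul0r subr0 addr0 !eqxx.
have rr : disc 0 d' ((r * cos theta) +i* (r * sin theta)).
  rewrite /disc /= !subr0 /= !exprMn -mulrDr cos2Dsin2 mulr1 sqrtr_sqr.
  by rewrite ger0_norm// ltW.
have [n0 Su] := uS _ rr.
have := qbound _ Su; rewrite /H.
by rewrite (point_barrier_disc p2).
Qed.

End MaximumPrinciple.

(** * Bootstrapping the decay *)

Section Bootstrap.
Variable R : realType.
Implicit Types p : 'cV[R]_4.
Variables (Omega : set 'cV[R]_4) (lambda : 'cV[R]_4 -> \bar R) (E0 rho : R).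
Hypothesis lam_psh : J_plurisubharmonic_on (@Jmx R) Omega lambda.
Hypothesis E01 : 0 < E0 <= 1.
Hypothesis rho01 : 0 < rho <= 1.
Hypothesis Omega_big : forall p, sqn1 p <= E0 -> 0 < sqn2 p -> 0 <= height rho p -> Omega p.
Hypothesis lam_height : forall p, sqn1 p <= E0 -> 0 < sqn2 p -> 0 <= height rho p ->
  (lambda p <= (- height rho p)%:E)%E.

Definition decay (k E T : R) : Prop := forall p, sqn1 p <= E -> 0 < sqn2 p ->
  T <= height rho p -> (lambda p <= (- (k * (E - sqn1 p)))%:E)%E.

Lemma sqn1_ge0 p : 0 <= sqn1 p.
Proof. by rewrite addr_ge0// sqr_ge0. Qed.

Lemma decay_base E T : E <= E0 -> 0 <= T -> decay T E T.
Proof.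
move=> EE T0 p pE p2 pT; have [e0 e1] := andP E01.
apply: le_trans (lam_height _ p2 _) _; rewrite ?(le_trans pE)// ?(le_trans T0)//.
rewrite lee_fin lerN2; apply: le_trans pT; rewrite ler_piMr//.
by have := sqn1_ge0 p; lra.
Qed.

Lemma decay_le k E E' T : 0 <= k -> E' <= E -> decay k E T -> decay k E' T.
Proof.
move=> k0 EE H p pE p2 pT; apply: le_trans (H p (le_trans pE EE) p2 pT) _.
by rewrite lee_fin lerN2 ler_wpM2l//; lra.
Qed.

(** For L/2 <= t <= L the profile is at least 1/2 + s/4, the linear value plus the gain from
    concavity. Lowering E by 4 c lowers the target by 2 c + s c, which covers the loss 2 c in
    [point_barrier_ge]. For t >= L the claim is weaker than the hypothesis, as 1/2 + s/4 <= 1. *)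
Lemma decay_halve k E s L : 0 < k -> 0 < E <= E0 -> 1 <= L -> 0 < s ->
  200 * (100 * s) <= E ^+ 2 ->
  decay k E L -> decay (k * (1 / 2 + s / 4)) (E - 4 * (s / L ^+ 2)) (L / 2).
Proof.
move=> k0 /andP[Ep EE] L1 s0 sE HL p pE p2 pL.
have [e0 e1] := andP E01.
have E1 : E <= 1 by lra.
have s1 : 2 * s <= 1.
  have : E ^+ 2 <= 1 by rewrite expr_le1 // ltW.
  by lra.
have L0 : 0 < L by lra.
have c0 : 0 < s / L ^+ 2 by rewrite divr_gt0 ?exprn_gt0.
set c := s / L ^+ 2 in pE c0 *.
have p1 : sqn1 p <= E by lra.
have [hL|hL] := leP L (height rho p).
  apply: le_trans (HL p p1 p2 hL) _; rewrite lee_fin lerN2 -mulrA ler_pM2l//.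
  have x0 : 0 <= E - 4 * c - sqn1 p by lra.
  have : (1 / 2 + s / 4) * (E - 4 * c - sqn1 p) <= 1 * (E - 4 * c - sqn1 p).
    by rewrite ler_wpM2r//; lra.
  by lra.
have Sp : shell E rho L p by split=> //; apply/andP; split; lra.
apply: le_trans (barrier_maximum_principle lam_psh _ L1 s0 sE rho01 k0 _ _ _ Sp) _.
- by rewrite Ep.
- by move=> q [q1 q2 /andP[q3 _]]; apply: Omega_big => //; lra.
- move=> q [q1 q2 /andP[q3 _]]; apply: le_trans (lam_height _ q2 q3) _; first by lra.
  by rewrite lee_fin; lra.
- by move=> q [q1 q2 _] qL; apply: HL => //; rewrite qL.
rewrite lee_fin lerN2 -mulrA ler_pM2l//.
have := @point_barrier_ge R E ((1 + s) / L) c rho p (ltW c0) E1 p1 p2.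
set u := height rho p / L.
have u1 : 1 / 2 <= u by rewrite /u ler_pdivlMr//; lra.
have u2 : u <= 1 by rewrite /u ler_pdivrMr//; lra.
have -> : (1 + s) / L * height rho p - c * height rho p ^+ 2 = u * (1 + s - s * u).
  by rewrite /u /c; field; rewrite gt_eqF.
have fu : 1 / 2 + s / 4 <= u * (1 + s - s * u).
  have : 0 <= (u - 1 / 2) * (1 + s - s * (u + 1 / 2)).
    rewrite mulr_ge0 ?subr_ge0//.
    have : s * (u + 1 / 2) <= s * 2 by rewrite ler_pM2l//; lra.
    by lra.
  by lra.
have x0 : 0 <= E - sqn1 p by lra.
have := ler_wpM2l x0 fu.
have : 0 <= s * c by rewrite mulr_ge0// ltW.
lra.
Qed.

(** At L = 2^(M+1) the step costs 4 s / L^2 = s / 4^M; added to the 2 s / 4^(M+1) already lost this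
    is 3/2 s / 4^M, within the allowed 2 s / 4^M. So E stays at least 3 E0 / 4, and smallness of s
    against (E0 / 2)^2 covers every step. *)
Lemma decay_iter s N j : 0 < s -> 200 * (100 * s) <= (E0 / 2) ^+ 2 -> (j <= N)%N ->
  decay (2 ^+ N * (1 / 2 + s / 4) ^+ j) (E0 - 2 * s / 4 ^+ (N - j)) (2 ^+ (N - j)).
Proof.
move=> s0 sE; have [e0 e1] := andP E01.
have sE0 : 2 * s <= E0 / 4.
  have : E0 ^+ 2 <= E0 by rewrite expr2 ler_piMl// ltW.
  by move: sE; rewrite expr_div_n; lra.
elim: j => [_|j IH jN].
  rewrite subn0 expr0 mulr1; apply: decay_base; last by rewrite exprn_ge0.
  by rewrite lerBlDr lerDl divr_ge0 ?exprn_ge0// mulr_ge0// ltW.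
have := IH (ltnW jN); rewrite -(subnSK jN); set M := (N - j.+1)%N => H.
have M1 : 1 <= 2 ^+ M.+1 :> R by rewrite exprn_ege1// ler1n.
have M4 : 0 < 4 ^+ M.+1 :> R by rewrite exprn_gt0.
have M4' : 1 <= 4 ^+ M.+1 :> R by rewrite exprn_ege1// ler1n.
have sM : 2 * s / 4 ^+ M.+1 <= E0 / 4.
  by apply: le_trans sE0; rewrite ler_pdivrMr// ler_peMr// mulr_ge0// ltW.
have sM0 : 0 < 2 * s / 4 ^+ M.+1 by rewrite divr_gt0// mulr_gt0.
have q0 : 0 < 1 / 2 + s / 4 by lra.
have k0 : 0 < 2 ^+ N * (1 / 2 + s / 4) ^+ j by rewrite mulr_gt0// exprn_gt0.
have := decay_halve k0 _ M1 s0 _ H.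
have -> : 2 ^+ M.+1 / 2 = 2 ^+ M :> R by rewrite exprS; field.
have -> : 2 ^+ N * (1 / 2 + s / 4) ^+ j * (1 / 2 + s / 4)
  = 2 ^+ N * (1 / 2 + s / 4) ^+ j.+1 by rewrite exprSr mulrA.
move=> H'.
apply: decay_le (H' _ _).
- by rewrite mulr_ge0 ?exprn_ge0// ltW.
- have -> : (2 ^+ M.+1) ^+ 2 = 4 ^+ M.+1 :> R.
    by rewrite exprAC; congr (_ ^+ _); ring.
  rewrite [4 ^+ M.+1]exprS; have M40 : 0 < 4 ^+ M :> R by rewrite exprn_gt0.
  have : 0 < s / 4 ^+ M by rewrite divr_gt0.
  have -> : 2 * s / (4 * 4 ^+ M) = (s / 4 ^+ M) / 2 by field; rewrite gt_eqF.
  have -> : 4 * (s / (4 * 4 ^+ M)) = s / 4 ^+ M by field; rewrite gt_eqF.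
  have -> : 2 * s / 4 ^+ M = 2 * (s / 4 ^+ M) by rewrite mulrA.
  by lra.
- by apply/andP; split; lra.
- apply: (le_trans sE); rewrite ler_sqr ?nnegrE; lra.
Qed.

(** After N halvings the factor is (1 + s/2)^N >= N s/2, while E - |z1|^2 stays above E0 / 4; hence
    lambda lies below every real number. *)
Lemma lambda_ninfty p : sqn1 p <= E0 / 4 -> 0 < sqn2 p -> 1 <= height rho p ->
  lambda p = -oo%E.
Proof.
move=> p1 p2 ph; have [e0 e1] := andP E01.
pose s := E0 ^+ 2 / (4 * (200 * 100)).
have s0 : 0 < s by rewrite divr_gt0 ?exprn_gt0 ?mulr_gt0.
have sE : 200 * (100 * s) <= (E0 / 2) ^+ 2.
  by rewrite le_eqVlt; apply/orP; left; apply/eqP; rewrite /s; field.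
have bd N : (lambda p <= (- (N%:R * (s / 2) * (E0 / 4)))%:E)%E.
  have := decay_iter s0 sE (leqnn N); rewrite subnn !expr0 divr1 => H.
  have s4 : 2 * s <= E0 / 4.
    have : E0 ^+ 2 <= E0 by rewrite expr2 ler_piMl// ltW.
    by move: sE; rewrite expr_div_n; lra.
  apply: le_trans (H p _ p2 ph) _; first by lra.
  rewrite lee_fin lerN2 -exprMn.
  have -> : 2 * (1 / 2 + s / 4) = 1 + s / 2 by field.
  apply: ler_pM; rewrite ?mulr_ge0 ?ler0n ?divr_ge0 ?(ltW s0) ?(ltW e0)//; last by lra.
  have s2 : 0 <= s / 2 by rewrite divr_ge0// ltW.
  elim: N {H} => [|N IH]; first by rewrite mul0r expr0.
  have X1 : 1 <= (1 + s / 2) ^+ N by rewrite exprn_ege1//; lra.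
  have := ler_wpM2l s2 X1; rewrite exprS -[N.+1%:R]natr1.
  move: ((1 + s / 2) ^+ N) (N%:R) IH => X n IH; lra.
have := bd 0%N; rewrite !mul0r oppr0.
case: (lambda p) bd => [l| |] //= bd _.
exfalso; have sE0 : 0 < s / 2 * (E0 / 4) by rewrite mulr_gt0// divr_gt0.
have := bd (Num.truncn (- l / (s / 2 * (E0 / 4)))).+1.
rewrite lee_fin leNgt => /negP; apply.
rewrite ltrNl -mulrA -ltr_pdivrMr//.
exact: truncnS_gt.
Qed.

End Bootstrap.

(** * From the bootstrap to a neighbourhood of the origin *)

Section Conclusion.
Variable R : realType.

Lemma J_psh_below_log_ninfty (Omega : set 'cV[R]_4) (lambda : 'cV[R]_4 -> \bar R) :
  open Omega -> Omega 0 -> J_plurisubharmonic_on (@Jmx R) Omega lambda ->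
  (forall p, Omega p -> (lambda p <= lne (normc (z2 p))%:E)%E) ->
  \forall p \near (0 : 'cV[R]_4), lambda p = -oo%E.
Proof.
move=> oO O0 psh lelog.
have /nbhs_ballP[e /= e0 He] : nbhs (0 : 'cV[R]_4) Omega by apply: open_nbhs_nbhs.
(* Both radii are d, that is E0 = d^2 and rho = d: d < e keeps the bidisc in [Omega], and d <= 1
   turns log |z2| = ln d - t into the bound - t. *)
pose d := Num.min (2^-1) (e / 2).
have d0 : 0 < d by rewrite lt_min invr_gt0 ltr0n divr_gt0.
have d1 : d <= 2^-1 by rewrite ge_min lexx.
have de : d < e by apply: (@le_lt_trans _ _ (e / 2)); [rewrite ge_min lexx orbT|lra].
have normc_z2 (p : 'cV[R]_4) : normc (z2 p) = Num.sqrt (sqn2 p) by [].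
have lnz2 (p : 'cV[R]_4) : 0 < sqn2 p -> lne (normc (z2 p))%:E = (ln (sqn2 p) / 2)%:E.
  move=> p2; rewrite normc_z2 lne_EFin ?sqrtr_gt0//; congr EFin.
  have -> : ln (sqn2 p) = ln (Num.sqrt (sqn2 p) ^+ 2) by rewrite sqr_sqrtr// ltW.
  by rewrite lnXn ?sqrtr_gt0// -mulr_natl; field.
have E01 : 0 < d ^+ 2 <= 1 by rewrite exprn_gt0//= expr_le1 ?ltW//; lra.
have rho01 : 0 < d <= 1 by rewrite d0; lra.
have small (x y : R) : x ^+ 2 + y ^+ 2 <= d ^+ 2 -> `|x| < e /\ `|y| < e.
  have [hx hy] := (sqr_ge0 x, sqr_ge0 y) => xy.
  split; apply: le_lt_trans de; rewrite -ler_sqr ?nnegrE ?(ltW d0)// real_normK ?num_real//; lra.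
have in_Omega (p : 'cV[R]_4) : sqn1 p <= d ^+ 2 -> sqn2 p <= d ^+ 2 -> Omega p.
  move=> /small[h0 h1] /small[h2 h3]; apply: He.
  rewrite -ball_normE /= sub0r normrN [ltLHS]/Num.Def.normr/= mx_normrE.
  apply/bigmax_ltP; split=> // -[i j] _ /=; rewrite (ord1 j).
  by move: i; apply: forall_ord4.
have le_d (p : 'cV[R]_4) : 0 < sqn2 p -> 0 <= height d p -> sqn2 p <= d ^+ 2.
  move=> p2; rewrite /height => h; rewrite -ler_ln ?posrE ?exprn_gt0//.
  by rewrite lnXn// -mulr_natl; lra.
have O_big (p : 'cV[R]_4) : sqn1 p <= d ^+ 2 -> 0 < sqn2 p -> 0 <= height d p -> Omega p.
  by move=> h1 h2 h3; apply: in_Omega => //; exact: le_d.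
have lam_h (p : 'cV[R]_4) : sqn1 p <= d ^+ 2 -> 0 < sqn2 p -> 0 <= height d p ->
    (lambda p <= (- height d p)%:E)%E.
  move=> h1 h2 h3; apply: le_trans (lelog p (O_big p h1 h2 h3)) _.
  rewrite lnz2// lee_fin /height.
  have : ln d <= 0 by rewrite ln_le0// (andP rho01).2.
  by lra.
have main := lambda_ninfty psh E01 rho01 O_big lam_h.
have r0 : 0 < (d * expR (-1)) ^+ 2 by rewrite exprn_gt0// mulr_gt0// expR_gt0.
have c1 : sqn1 (0 : 'cV[R]_4) < d ^+ 2 / 4.
  by rewrite /sqn1 !mxE expr0n /= addr0 divr_gt0// exprn_gt0.
have c2 : sqn2 (0 : 'cV[R]_4) < (d * expR (-1)) ^+ 2.
  by rewrite /sqn2 !mxE expr0n /= addr0.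
near=> p.
have p1 : sqn1 p < d ^+ 2 / 4.
  by near: p; apply: cvgr_lt c1; exact: continuous_sqn1.
have p2 : sqn2 p < (d * expR (-1)) ^+ 2.
  by near: p; apply: cvgr_lt c2; exact: continuous_sqn2.
(* On z2 = 0 the bound by [lne 0] gives the value -oo directly. *)
have [s0|s0] := leP (sqn2 p) 0.
  have Op : Omega p.
    apply: in_Omega; first by have := ltW (andP E01).1; lra.
    by apply: (le_trans s0); rewrite exprn_ge0// ltW.
  have := lelog p Op; rewrite normc_z2 ler0_sqrtr// le0_lneNy//.
  by rewrite leeNy_eq => /eqP.
apply: main => //; first exact: ltW.
rewrite /height; have : ln (sqn2 p) <= ln ((d * expR (-1)) ^+ 2).
  by rewrite ler_ln ?posrE// ltW.
rewrite lnXn ?mulr_gt0 ?expR_gt0// lnM ?posrE ?expR_gt0// expRK -mulr_natl; lra.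
Unshelve. all: by end_near. Qed.

End Conclusion.

(** * Characterization of the holomorphic maps *)

Section CauchyRiemann.
Variable R : realType.

Lemma normc_le_ReIm (z : R[i]) : normc z <= `|complex.Re z| + `|complex.Im z|.
Proof.
case: z => a b /=; rewrite -ler_sqr ?nnegrE ?sqrtr_ge0 ?addr_ge0//.
rewrite sqr_sqrtr ?addr_ge0 ?sqr_ge0// sqrrD !real_normK ?num_real//.
by rewrite lerD2r lerDl mulrn_wge0// mulr_ge0.
Qed.

(** Quotient-free form of complex differentiability, comparable with real increments along the
    axes. *)
Lemma complex_differenceP (f : R[i]^o -> R[i]^o) (zeta : R[i]^o) (l : R[i]) :
  ((fun h : R[i]^o => (h : R[i])^-1 *: ((f \o shift zeta) ((h : R[i]) *: (1 : R[i]^o)) - f zeta))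
    @ (0 : R[i]^o)^' --> (l : R[i]^o)) <->
  (forall e : R, 0 < e -> exists2 d : R, 0 < d & forall h : R[i], normc h < d ->
    normc (f (zeta + h : R[i]) - f zeta - l * h) <= e * normc h).
Proof.
split.
  move=> /cvgrPdist_le H e e0.
  have eC : 0 < e%:C :> R[i] by rewrite ltcR.
  have := H _ eC; rewrite /dnbhs /within /= => /nbhs_disc[d d0 Hd].
  exists d => // h hd; have [->|h0] := eqVneq h 0.
    by rewrite addr0 subrr sub0r mulr0 oppr0 normc0 mulr0.
  have := Hd h; rewrite /disc /= subr0 => /(_ hd h0).
  rewrite normc_norm lecR => Hh.
  have -> : f (zeta + h : R[i]) - f zeta - l * h
     = - ((l - h^-1 * (f (h * 1 + zeta : R[i]) - f zeta)) * h).
    by rewrite mulr1 (addrC h); field.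
  have nh : 0 <= normc h by case: (h) => a b; exact: sqrtr_ge0.
  by rewrite normcN normcM; apply: ler_wpM2r nh _ _ Hh.
move=> H; apply/(@cvgrPdist_le _ _ _ (dnbhs (0 : R[i]^o))) => e e0.
have [eE ep] := gt0_complexE e0.
have [d d0 Hd] := H _ ep.
rewrite /dnbhs /within /=; apply/nbhs_disc; exists d => // h; rewrite /disc /= subr0 => hd h0.
have nh0 : 0 < normc h by rewrite -ltcR -normc_norm normr_gt0.
rewrite eE normc_norm lecR -(ler_pM2r nh0) -normcM.
have -> : (l - h^-1 *: (f (h *: 1 + zeta) - f zeta)) * h
     = - (f (zeta + h : R[i]) - f zeta - l * h).
  by rewrite /GRing.scale /= mulr1 (addrC h); field.
by rewrite normcN; exact: Hd.
Qed.

Lemma real_differenceP (g : R -> R) (a : R) :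
  (forall e : R, 0 < e -> exists2 d : R, 0 < d & forall t : R, `|t| < d ->
    `|g t - g 0 - a * t| <= e * `|t|) -> is_derive (0 : R) 1 g a.
Proof.
move=> H.
have L : h^-1 *: ((g \o shift 0) (h *: (1 : R)) - g 0) @[h --> 0^'] --> a.
  apply/cvgrPdist_le => e e0; have [d d0 Hd] := H _ e0.
  apply/nbhs_ballP; exists d => // h; rewrite /ball /= sub0r normrN => hd h0.
  have nh : 0 < `|h| by rewrite normr_gt0.
  rewrite -(ler_pM2r nh) -normrM.
  have -> : (a - h^-1 *: (g (h *: 1 + 0) - g 0)) * h = - (g h - g 0 - a * h).
    by rewrite /GRing.scale /= mulr1 addr0; field.
  by rewrite normrN; exact: Hd.
split; first by apply/cvg_ex; exists a.
exact: cvg_lim L.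
Qed.

(** The increment is split along a vertical and a horizontal segment; on each, U minus its linear
    part has a derivative bounded by e/2, by continuity of the partial derivatives. *)
Lemma C1_difference (U Ux Uy : R[i]^o -> R) (D : set R[i]^o) (zeta : R[i]^o) :
  open D -> D zeta ->
  (forall w, D w -> is_derive (0 : R) 1 (U \o xline w) (Ux w)) ->
  (forall w, D w -> is_derive (0 : R) 1 (U \o yline w) (Uy w)) ->
  {for zeta, continuous Ux} -> {for zeta, continuous Uy} ->
  forall e : R, 0 < e -> exists2 d : R, 0 < d & forall h : R[i], normc h < d ->
    `|U (zeta + h : R[i]) - U zeta - (Ux zeta * complex.Re h + Uy zeta * complex.Im h)|
      <= e * normc h.
Proof.
move=> oD Dz dUx dUy cUx cUy e e0.
have e2 : 0 < e / 2 by rewrite divr_gt0.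
have : \forall w \near zeta, [/\ D w, `|Ux w - Ux zeta| <= e / 2 & `|Uy w - Uy zeta| <= e / 2].
  have h1 : \forall w \near zeta, D w by apply: open_nbhs_nbhs.
  have h2 : \forall w \near zeta, `|Ux w - Ux zeta| <= e / 2.
    by apply: ((@cvgrPdistC_le _ _ _ (nbhs zeta) _ Ux (Ux zeta)).1 cUx _ e2).
  have h3 : \forall w \near zeta, `|Uy w - Uy zeta| <= e / 2.
    by apply: ((@cvgrPdistC_le _ _ _ (nbhs zeta) _ Uy (Uy zeta)).1 cUy _ e2).
  by near=> w; split; near: w.
move=> /nbhs_disc[d d0 Hd]; exists (d / 2); first by rewrite divr_gt0.
move=> h hd.
have inD (s t : R) : `|s| < d / 2 -> `|t| < d / 2 ->
    [/\ D ((zeta : R[i]) + (s +i* t)), `|Ux ((zeta : R[i]) + (s +i* t)) - Ux zeta| <= e / 2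
      & `|Uy ((zeta : R[i]) + (s +i* t)) - Uy zeta| <= e / 2].
  move=> hs ht; apply: Hd; rewrite /disc /= addrC addKr.
  by apply: le_lt_trans (normc_le_ReIm _) _; rewrite /=; lra.
case: h hd => s t hd.
have hs : `|s| < d / 2 by apply: le_lt_trans hd; exact: (ler_Re_normc (s +i* t)).
have ht : `|t| < d / 2 by apply: le_lt_trans hd; exact: (ler_Im_normc (s +i* t)).
have z0 : `|0 : R| < d / 2 by rewrite normr0 divr_gt0.
pose W (a b : R) : R[i]^o := (zeta : R[i]) + (a +i* b).
have dX (b a : R) : `|b| < d / 2 -> `|a| < d / 2 ->
    is_derive a (1 : R) (fun x : R => U (W x b) - U (W 0 b) - Ux zeta * x) (Ux (W a b) - Ux zeta).
  move=> hb ha; have [Dw _ _] := inD a b ha hb.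
  have sh : is_derive a (1 : R) (fun x : R => x - a) 1.
    by apply: is_derive_eq; rewrite /GRing.scale /=; ring.
  have h0 : is_derive (a - a) 1 (U \o xline (W a b)) (Ux (W a b)).
    by rewrite subrr; exact: dUx.
  have := @is_derive1_comp R (U \o xline (W a b)) (fun x : R => x - a) a _ _ h0 sh.
  rewrite mulr1.
  have -> : (U \o xline (W a b)) \o (fun x : R => x - a) = (fun x : R => U (W x b)).
    apply/funext => x /=; congr U; rewrite /xline /W -addrA; congr (_ + _).
    by apply/eqP; rewrite eq_complex /= addrC subrK addr0 !eqxx.
  by move=> h1; apply: is_derive_eq; rewrite /GRing.scale /=; ring.
have dY (b : R) : `|b| < d / 2 ->
    is_derive b (1 : R) (fun y : R => U (W 0 y) - U (W 0 0) - Uy zeta * y) (Uy (W 0 b) - Uy zeta).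
  move=> hb; have [Dw _ _] := inD 0 b z0 hb.
  have sh : is_derive b (1 : R) (fun x : R => x - b) 1.
    by apply: is_derive_eq; rewrite /GRing.scale /=; ring.
  have h0 : is_derive (b - b) 1 (U \o yline (W 0 b)) (Uy (W 0 b)).
    by rewrite subrr; exact: dUy.
  have := @is_derive1_comp R (U \o yline (W 0 b)) (fun x : R => x - b) b _ _ h0 sh.
  rewrite mulr1.
  have -> : (U \o yline (W 0 b)) \o (fun x : R => x - b) = (fun x : R => U (W 0 x)).
    apply/funext => x /=; congr U; rewrite /yline /W -addrA; congr (_ + _).
    by apply/eqP; rewrite eq_complex /= (addrC b) subrK addr0 !eqxx.
  by move=> h1; apply: is_derive_eq; rewrite /GRing.scale /=; ring.
have BX := @bound_of_derivative R (fun x : R => U (W x t) - U (W 0 t) - Ux zeta * x)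
  (fun x => Ux (W x t) - Ux zeta) 0 (e / 2) (d / 2).
have BY := @bound_of_derivative R (fun y : R => U (W 0 y) - U (W 0 0) - Uy zeta * y)
  (fun y => Uy (W 0 y) - Uy zeta) 0 (e / 2) (d / 2).
have {}BX : `|U (W s t) - U (W 0 t) - Ux zeta * s| <= e / 2 * `|s| ^+ 1.
  apply: BX => //.
  - by rewrite subrr mulr0 subr0.
  - by move=> x hx; exact: dX.
  - by move=> x hx; rewrite expr0 mulr1; have [] := inD x t hx ht.
have {}BY : `|U (W 0 t) - U (W 0 0) - Uy zeta * t| <= e / 2 * `|t| ^+ 1.
  apply: BY => //.
  - by rewrite subrr mulr0 subr0.
  - by move=> y hy; rewrite expr0 mulr1; have [] := inD 0 y z0 hy.
have W00 : W 0 0 = zeta.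
  by rewrite /W (_ : 0 +i* 0 = 0 :> R[i])// addr0.
rewrite W00 in BY.
have -> : U (zeta + (s +i* t) : R[i]) - U zeta - (Ux zeta * s + Uy zeta * t)
   = (U (W s t) - U (W 0 t) - Ux zeta * s) + (U (W 0 t) - U zeta - Uy zeta * t).
  by rewrite /W; ring.
apply: le_trans (ler_normD _ _) _.
have n1 := ler_Re_normc (s +i* t); have n2 := ler_Im_normc (s +i* t).
have := ler_wpM2l (ltW e2) n1; have := ler_wpM2l (ltW e2) n2.
rewrite !expr1 in BX BY; move: BX BY; rewrite /=; lra.
Unshelve. all: by end_near. Qed.

End CauchyRiemann.

Section JHolomorphic.
Variable R : realType.

Lemma complex_increment (U V U0 V0 a b : R) (h : R[i]) :
  (U +i* V) - (U0 +i* V0) - (a +i* b) * h =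
  (U - U0 - (a * complex.Re h + - b * complex.Im h))
    +i* (V - V0 - (b * complex.Re h + a * complex.Im h)).
Proof. by case: h => s t; apply/eqP; rewrite eq_complex /=; apply/andP; split; apply/eqP; ring. Qed.

Variables (n : nat) (D : set R[i]^o) (u : R[i]^o -> 'cV[R]_n).
Hypothesis C1u : C1_on D u.

Lemma is_derive_xcoord w i : D w ->
  is_derive (0 : R) 1 ((fun z => u z i 0) \o xline w) (dx u w i 0).
Proof.
move=> Dw; have [hx _ _ _] := C1u Dw.
split; first by have /derivable_mxP/(_ i 0) := hx.
by rewrite /dx derive_mx// mxE.
Qed.

Lemma is_derive_ycoord w i : D w ->
  is_derive (0 : R) 1 ((fun z => u z i 0) \o yline w) (dy u w i 0).
Proof.
move=> Dw; have [_ hy _ _] := C1u Dw.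
split; first by have /derivable_mxP/(_ i 0) := hy.
by rewrite /dy derive_mx// mxE.
Qed.

Lemma dx_coord w i : D w -> dx (fun z => u z i 0) w = dx u w i 0.
Proof. by move=> /(is_derive_xcoord i)[_ <-]. Qed.

Lemma dy_coord w i : D w -> dy (fun z => u z i 0) w = dy u w i 0.
Proof. by move=> /(is_derive_ycoord i)[_ <-]. Qed.

Lemma dxN_coord w i : D w -> dx (fun z => - u z i 0) w = - dx u w i 0.
Proof.
move=> /(is_derive_xcoord i) h; rewrite /dx.
by have [_] := is_deriveN h.
Qed.

Lemma dyN_coord w i : D w -> dy (fun z => - u z i 0) w = - dy u w i 0.
Proof.
move=> /(is_derive_ycoord i) h; rewrite /dy.
by have [_] := is_deriveN h.
Qed.

Lemma coord_difference zeta i : open D -> D zeta ->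
  forall e : R, 0 < e -> exists2 d : R, 0 < d & forall h : R[i], normc h < d ->
    `|u (zeta + h : R[i]) i 0 - u zeta i 0
       - (dx u zeta i 0 * complex.Re h + dy u zeta i 0 * complex.Im h)| <= e * normc h.
Proof.
move=> oD Dz; have [_ _ cx cy] := C1u Dz.
have kx : {for zeta, continuous (fun w => dx u w i 0)}.
  apply: (@continuous_comp _ _ _ (dx u) (fun p : 'cV[R]_n => p i 0)); first exact: cx.
  exact: coord_continuous.
have ky : {for zeta, continuous (fun w => dy u w i 0)}.
  apply: (@continuous_comp _ _ _ (dy u) (fun p : 'cV[R]_n => p i 0)); first exact: cy.
  exact: coord_continuous.
have := @C1_difference R (fun z => u z i 0) _ _ D zeta oD Dz
  (fun w => @is_derive_xcoord w i) (fun w => @is_derive_ycoord w i) kx ky.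
by [].
Qed.

Lemma holomorphic_of_CR zeta i j : open D -> D zeta ->
  dy u zeta i 0 = - dx u zeta j 0 -> dy u zeta j 0 = dx u zeta i 0 ->
  derivable (fun z : R[i]^o => (u z i 0 +i* u z j 0) : R[i]^o) zeta 1.
Proof.
move=> oD Dz e1 e2; apply/cvg_ex.
exists ((dx u zeta i 0 +i* dx u zeta j 0) : R[i]^o).
apply/complex_differenceP => e e0.
have ep : 0 < e / 2 by rewrite divr_gt0.
have [d1 d10 H1] := coord_difference i oD Dz ep.
have [d2 d20 H2] := coord_difference j oD Dz ep.
exists (Num.min d1 d2); first by rewrite lt_min d10.
move=> h; rewrite lt_min => /andP[/H1 h1 /H2 h2].
rewrite e1 in h1; rewrite e2 in h2.
rewrite complex_increment; apply: le_trans (normc_le_ReIm _) _.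
by apply: le_trans (lerD h1 h2) _; rewrite -mulrDl -splitr.
Qed.

(** A real step t changes the function by l t and an imaginary one by i l t, up to o(t), so all four
    partial derivatives are read off from l. *)
Lemma CR_of_holomorphic zeta i j : D zeta ->
  derivable (fun z : R[i]^o => (u z i 0 +i* u z j 0) : R[i]^o) zeta 1 ->
  dy u zeta i 0 = - dx u zeta j 0 /\ dy u zeta j 0 = dx u zeta i 0.
Proof.
move=> Dz /cvg_ex[l /complex_differenceP H].
have Hx e : 0 < e -> exists2 d : R, 0 < d & forall t : R, `|t| < d ->
    `|u (xline zeta t) i 0 - u (xline zeta 0) i 0 - complex.Re (l : R[i]) * t| <= e * `|t| /\
    `|u (xline zeta t) j 0 - u (xline zeta 0) j 0 - complex.Im (l : R[i]) * t| <= e * `|t|.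
  move=> e0; have [d d0 Hd] := H e e0; exists d => // t td.
  have nt : normc (t%:C : R[i]) = `|t| by rewrite /= expr0n /= addr0 sqrtr_sqr.
  have := Hd t%:C; rewrite nt => /(_ td) h.
  have x0 : xline zeta 0 = zeta by rewrite /xline addr0.
  rewrite x0; split.
    apply: le_trans h; apply: le_trans (ler_Re_normc _).
    rewrite le_eqVlt; apply/orP; left; apply/eqP; congr `|_|.
    by rewrite /xline; case: (l : R[i]) => a b /=; ring.
  apply: le_trans h; apply: le_trans (ler_Im_normc _).
  rewrite le_eqVlt; apply/orP; left; apply/eqP; congr `|_|.
  by rewrite /xline; case: (l : R[i]) => a b /=; ring.
have Hy e : 0 < e -> exists2 d : R, 0 < d & forall t : R, `|t| < d ->
    `|u (yline zeta t) i 0 - u (yline zeta 0) i 0 - - complex.Im (l : R[i]) * t| <= e * `|t| /\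
    `|u (yline zeta t) j 0 - u (yline zeta 0) j 0 - complex.Re (l : R[i]) * t| <= e * `|t|.
  move=> e0; have [d d0 Hd] := H e e0; exists d => // t td.
  have nt : normc (t*i : R[i]) = `|t| by rewrite /= expr0n /= add0r sqrtr_sqr.
  have := Hd t*i; rewrite nt => /(_ td) h.
  have x0 : yline zeta 0 = zeta by rewrite /yline addr0.
  rewrite x0; split.
    apply: le_trans h; apply: le_trans (ler_Re_normc _).
    rewrite le_eqVlt; apply/orP; left; apply/eqP; congr `|_|.
    by rewrite /yline; case: (l : R[i]) => a b /=; ring.
  apply: le_trans h; apply: le_trans (ler_Im_normc _).
  rewrite le_eqVlt; apply/orP; left; apply/eqP; congr `|_|.
  by rewrite /yline; case: (l : R[i]) => a b /=; ring.
have X k a : (forall e : R, 0 < e -> exists2 d : R, 0 < d & forall t : R, `|t| < d ->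
    `|u (xline zeta t) k 0 - u (xline zeta 0) k 0 - a * t| <= e * `|t|) -> dx u zeta k 0 = a.
  move=> h; have [_ <-] := is_derive_xcoord k Dz.
  by have [_ ->] := @real_differenceP R ((fun z => u z k 0) \o xline zeta) a h.
have Y k a : (forall e : R, 0 < e -> exists2 d : R, 0 < d & forall t : R, `|t| < d ->
    `|u (yline zeta t) k 0 - u (yline zeta 0) k 0 - a * t| <= e * `|t|) -> dy u zeta k 0 = a.
  move=> h; have [_ <-] := is_derive_ycoord k Dz.
  by have [_ ->] := @real_differenceP R ((fun z => u z k 0) \o yline zeta) a h.
have xi : dx u zeta i 0 = complex.Re (l : R[i]).
  by apply: X => e /Hx[d d0 Hd]; exists d => // t /Hd[].
have xj : dx u zeta j 0 = complex.Im (l : R[i]).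
  by apply: X => e /Hx[d d0 Hd]; exists d => // t /Hd[].
split.
  by rewrite xj; apply: Y => e /Hy[d d0 Hd]; exists d => // t /Hd[].
by rewrite xi; apply: Y => e /Hy[d d0 Hd]; exists d => // t /Hd[].
Qed.

End JHolomorphic.

Section Characterization.
Variable R : realType.

(** The a's stand for x-derivatives of the coordinates and the c's for y-derivatives; those of u1 in
    y are already replaced by - a1 and a0, by the Cauchy-Riemann equations. *)
Lemma wirtinger_eqP (a0 a1 a2 a3 c2 c3 x y : R) :
  ((a2 +i* - a3) - 'i * (c2 +i* - c3)) / 2%:R
    = (x +i* y) * (((a0 +i* a1) - 'i * (- a1 +i* a0)) / 2%:R) :> R[i] <->
  a2 - c3 = 2 * (x * a0 - y * a1) /\ - a3 - c2 = 2 * (x * a1 + y * a0).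
Proof.
have two : (2%:R : R[i]) != 0 by rewrite pnatr_eq0.
rewrite [RHS]mulrA; split.
  move=> /(mulIf (invr_neq0 two))/eqP; rewrite eq_complex /= => /andP[/eqP h1 /eqP h2].
  by split; lra.
move=> [h1 h2]; congr (_ * _); apply/eqP; rewrite eq_complex /=.
by apply/andP; split; apply/eqP; lra.
Qed.

Lemma lower_rows_eqP (a0 a1 a2 a3 c2 c3 x y : R) :
  (a2 - c3 = 2 * (x * a0 - y * a1) /\ - a3 - c2 = 2 * (x * a1 + y * a0)) <->
  (c2 = - (2 * y) * a0 - 2 * x * a1 - a3 /\ c3 = - (2 * x) * a0 + 2 * y * a1 + a2).
Proof. by split=> -[h2 h3]; split; lra. Qed.

(** The first two rows of the equation for J are the Cauchy-Riemann equations of u1; given these,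
    the last two are the real and imaginary parts of the Wirtinger equation. *)
Lemma J_holomorphicP (D : set R[i]^o) (u : R[i]^o -> 'cV[R]_4) : open D -> C1_on D u ->
  (J_holomorphic_on (@Jmx R) D u <->
   holomorphic_on D (fun zeta => z1 (u zeta)) /\
   forall zeta, D zeta ->
     dzeta (fun w => (z2 (u w))^*) zeta = z2 (u zeta) * dzeta (fun w => z1 (u w)) zeta).
Proof.
move=> oD C1u.
have dzE zeta : D zeta -> dy u zeta 0 0 = - dx u zeta 1 0 -> dy u zeta 1 0 = dx u zeta 0 0 ->
   (dzeta (fun w => (z2 (u w))^*) zeta = z2 (u zeta) * dzeta (fun w => z1 (u w)) zeta <->
    dy u zeta = Jmx (u zeta) *m dx u zeta).
  move=> Dz e1 e2.
  have [j0 j1 j2 j3] := JmxE (u zeta) (dx u zeta).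
  have X0 : dx (fun w => complex.Re (z1 (u w))) zeta = dx u zeta 0 0
    by exact: (@dx_coord _ _ _ _ C1u zeta 0 Dz).
  have X1 : dx (fun w => complex.Im (z1 (u w))) zeta = dx u zeta 1 0
    by exact: (@dx_coord _ _ _ _ C1u zeta 1 Dz).
  have Y0 : dy (fun w => complex.Re (z1 (u w))) zeta = - dx u zeta 1 0.
    by rewrite -e1; exact: (@dy_coord _ _ _ _ C1u zeta 0 Dz).
  have Y1 : dy (fun w => complex.Im (z1 (u w))) zeta = dx u zeta 0 0.
    by rewrite -e2; exact: (@dy_coord _ _ _ _ C1u zeta 1 Dz).
  have X2 : dx (fun w => complex.Re ((z2 (u w))^*)) zeta = dx u zeta 2 0
    by exact: (@dx_coord _ _ _ _ C1u zeta 2 Dz).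
  have X3 : dx (fun w => complex.Im ((z2 (u w))^*)) zeta = - dx u zeta 3 0
    by exact: (@dxN_coord _ _ _ _ C1u zeta 3 Dz).
  have Y2 : dy (fun w => complex.Re ((z2 (u w))^*)) zeta = dy u zeta 2 0
    by exact: (@dy_coord _ _ _ _ C1u zeta 2 Dz).
  have Y3 : dy (fun w => complex.Im ((z2 (u w))^*)) zeta = - dy u zeta 3 0
    by exact: (@dyN_coord _ _ _ _ C1u zeta 3 Dz).
  have := wirtinger_eqP (dx u zeta 0 0) (dx u zeta 1 0) (dx u zeta 2 0) (dx u zeta 3 0)
    (dy u zeta 2 0) (dy u zeta 3 0) (u zeta 2 0) (u zeta 3 0).
  rewrite /dzeta; cbv beta zeta; rewrite X0 X1 X2 X3 Y0 Y1 Y2 Y3 => W.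
  apply: (iff_trans W); clear -e1 e2 j0 j1 j2 j3.
  apply: (iff_trans (lower_rows_eqP _ _ _ _ _ _ _ _)); rewrite -j2 -j3.
  split=> [[h2 h3]|<-//].
  by apply: col4P; [rewrite j0 e1|rewrite j1 e2|exact: h2|exact: h3].
split=> [[_ E]|[hol dz]].
  have CR zeta : D zeta -> dy u zeta 0 0 = - dx u zeta 1 0 /\ dy u zeta 1 0 = dx u zeta 0 0.
    by move=> /E ->; have [-> -> _ _] := JmxE (u zeta) (dx u zeta).
  split=> zeta Dz; have [e1 e2] := CR zeta Dz.
    exact: (holomorphic_of_CR C1u oD Dz e1 e2).
  by apply/dzE => //; exact: E.
split=> // zeta Dz.
have [e1 e2] := CR_of_holomorphic C1u Dz (hol zeta Dz).
by apply/dzE => //; exact: dz.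
Qed.

End Characterization.

Unset Implicit Arguments.

Theorem proposition2 (R : realType) :
  [/\ almost_complex_structure (@Jmx R),
      forall (D : set R[i]^o) (u : R[i]^o -> 'cV[R]_4),
        open D -> C1_on D u ->
        (J_holomorphic_on (@Jmx R) D u <->
         holomorphic_on D (fun zeta => z1 (u zeta)) /\
         forall zeta, D zeta ->
           dzeta (fun w => (z2 (u w))^*) zeta
           = z2 (u zeta) * dzeta (fun w => z1 (u w)) zeta) &
      ~ exists (Omega : set 'cV[R]_4) (lambda : 'cV[R]_4 -> \bar R),
          [/\ open Omega, Omega 0,
              J_plurisubharmonic_on (@Jmx R) Omega lambda,
              ~ (\forall p \near (0 : 'cV[R]_4), lambda p = -oo%E) &
              forall p, Omega p -> (lambda p <= lne (normc (z2 p))%:E)%E]].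
Proof.
split; first exact: Jmx_almost_complex.
  by move=> D u; exact: J_holomorphicP.
case=> Omega; case=> lambda; case=> oO O0 psh nontrivial bound.
exact: nontrivial (J_psh_below_log_ninfty oO O0 psh bound).
Qed.
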